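(* Let $\sigma$ be as in the context (in particular $\sigma(1)<1$), with the exponent $\alpha$ of condition $(\Sigma 3)$ satisfying $\alpha>1$, and assume that $M_1(\phi_\sigma')<+\infty$. Let $f\in C(I)$ be such that $$\|K_n(f,\cdot)-f(\cdot)\|_\infty=\mathcal O(n^{-\nu}),\qquad n\to+\infty,$$ for some $0<\nu<1$. Then $f\in Lip(\nu)$.
   Context: $\sigma:\mathbb R\to\mathbb R$ is a non-decreasing sigmoidal function ($\lim_{x\to-\infty}\sigma(x)=0$, $\lim_{x\to+\infty}\sigma(x)=1$) satisfying: $(\Sigma1)$ $\sigma(x)-1/2$ is an odd function; $(\Sigma2)$ $\sigma\in C^2(\mathbb R)$ and $\sigma$ is concave on $[0,+\infty)$; $(\Sigma3)$ $\sigma(x)=\mathcal O(|x|^{-1-\alpha})$ as $x\to-\infty$, for some $\alpha>0$; moreover $\sigma(1)<1$ (standing assumption under which the Kantorovich operators below are well defined). Set $\phi_\sigma(x):=\frac12[\sigma(x+1)-\sigma(x-1)]$ and $\Psi_\sigma(\mathbf x):=\prod_{i=1}^d\phi_\sigma(x_i)$ for $\mathbf x\in\mathbb R^d$. For $g:\mathbb R\to\mathbb R$ and $\beta\ge0$, $M_\beta(g):=\sup_{x\in\mathbb R}\sum_{k\in\mathbb Z}|g(x-k)|\,|k-x|^\beta$. Let $I=\prod_{i=1}^d[a_i,b_i]$ with $a_i<b_i$; $C(I)$ carries the sup-norm. Let $\mathcal K_n:=\{\mathbf k\in\mathbb Z^d:\lceil na_i\rceil\le k_i\le\lfloor nb_i\rfloor-1,\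 i=1,\dots,d\}$. For locally integrable $f:I\to\mathbb R$ and $n\in\mathbb N^+$, the Kantorovich neural network operators are $$K_n(f,\mathbf x):=\frac{\sum_{\mathbf k\in\mathcal K_n}\Big[n^d\int_{R_{\mathbf k,n}}f(\mathbf u)\,d\mathbf u\Big]\Psi_\sigma(n\mathbf x-\mathbf k)}{\sum_{\mathbf k\in\mathcal K_n}\Psi_\sigma(n\mathbf x-\mathbf k)},\qquad \mathbf x\in I,$$ where $R_{\mathbf k,n}:=\prod_{i=1}^d[k_i/n,(k_i+1)/n]$. The modulus of continuity is $\omega(f,\delta):=\sup\{|f(\mathbf x)-f(\mathbf y)|:\mathbf x,\mathbf y\in I,\ \|\mathbf x-\mathbf y\|_2\le\delta\}$, and for $0<\nu\le1$, $Lip(\nu):=\{f\in C(I):\omega(f,\delta)=\mathcal O(\delta^\nu)\text{ as }\delta\to0^+\}$. *)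

(* Defs.v *)
From Stdlib Require Import Reals ZArith.
From Coquelicot Require Import Coquelicot.
From mathcomp Require Import ssreflect ssrbool ssrfun eqtype ssrnat seq fintype bigop.

Set Implicit Arguments.
Unset Strict Implicit.
Unset Printing Implicit Defensive.

Local Open Scope R_scope.

(* Stdlib's [up x] is the unique integer with x < up x <= x + 1. *)
Definition Zfloor (x : R) : Z := (up x - 1)%Z.
Definition Zceil (x : R) : Z := (- Zfloor (- x))%Z.

Definition Zrange (l h : Z) : seq Z :=
  map (fun j => (l + Z.of_nat j)%Z) (iota 0 (Z.to_nat (h - l + 1))).

Definition upd {T : Type} (d : nat) (x : 'I_d -> T) (i : 'I_d) (t : T) : 'I_d -> T :=
  fun m => if m == i then t else x m.

(* all k in Z^d with lo i <= k i <= hi i for every i (each listed once) *)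
Definition box_idx (d : nat) (lo hi : 'I_d -> Z) : seq ('I_d -> Z) :=
  foldr (fun i acc =>
           flatten (map (fun k => map (fun j => upd k i j) (Zrange (lo i) (hi i))) acc))
        [:: fun _ => 0%Z] (enum 'I_d).

Definition box_int (d : nat) (lo hi : 'I_d -> R) (g : ('I_d -> R) -> R) : R :=
  (foldr (fun i (G : ('I_d -> R) -> R) =>
            fun x => RInt (fun t => G (upd x i t)) (lo i) (hi i))
         g (enum 'I_d)) (fun _ => 0).

Definition dist2 (d : nat) (x y : 'I_d -> R) : R :=
  sqrt (\big[Rplus/0]_(i < d) ((x i - y i) ^ 2)).

Definition inI (d : nat) (a b x : 'I_d -> R) : Prop :=
  forall i, a i <= x i <= b i.

Definition phi_sigma (sigma : R -> R) (x : R) : R :=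
  / 2 * (sigma (x + 1) - sigma (x - 1)).

Definition Psi_sigma (d : nat) (sigma : R -> R) (x : 'I_d -> R) : R :=
  \big[Rmult/1]_(i < d) phi_sigma sigma (x i).

(* M_beta(g) = sup_x sum_{k in Z} |g(x-k)| |k-x|^beta  (beta a natural number here);
   the series of nonnegative terms is the sup of its symmetric partial sums *)
Definition M_beta (beta : nat) (g : R -> R) : Rbar :=
  Lub_Rbar (fun r => exists (x : R) (N : nat),
    r = \big[Rplus/0]_(k <- Zrange (- Z.of_nat N) (Z.of_nat N))
          (Rabs (g (x - IZR k)) * Rabs (IZR k - x) ^ beta)).

Definition K_n (d : nat) (sigma : R -> R) (a b : 'I_d -> R)
    (f : ('I_d -> R) -> R) (n : nat) (x : 'I_d -> R) : R :=
  let lo := fun i => Zceil (INR n * a i) in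
  let hi := fun i => (Zfloor (INR n * b i) - 1)%Z in
  let ks := box_idx lo hi in
  let w := fun k : 'I_d -> Z => Psi_sigma sigma (fun i => INR n * x i - IZR (k i)) in
  (\big[Rplus/0]_(k <- ks)
      ((INR n ^ d * box_int (fun i => IZR (k i) / INR n)
                            (fun i => (IZR (k i) + 1) / INR n) f) * w k))
  / (\big[Rplus/0]_(k <- ks) w k).

Definition supnorm_I (d : nat) (a b : 'I_d -> R) (g : ('I_d -> R) -> R) : Rbar :=
  Lub_Rbar (fun r => exists x, inI a b x /\ r = Rabs (g x)).

Definition cont_on_I (d : nat) (a b : 'I_d -> R) (f : ('I_d -> R) -> R) : Prop :=
  forall x, inI a b x -> forall eps, 0 < eps -> exists delta, 0 < delta /\
    forall y, inI a b y -> dist2 x y < delta -> Rabs (f y - f x) < eps.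

Definition omega (d : nat) (a b : 'I_d -> R) (f : ('I_d -> R) -> R) (delta : R) : Rbar :=
  Lub_Rbar (fun r => exists x y, inI a b x /\ inI a b y /\ dist2 x y <= delta
                                 /\ r = Rabs (f x - f y)).

Definition Lip (d : nat) (a b : 'I_d -> R) (nu : R) (f : ('I_d -> R) -> R) : Prop :=
  cont_on_I a b f /\
  exists C delta0, 0 < delta0 /\
    forall delta, 0 < delta <= delta0 -> Rbar_le (omega a b f delta) (C * Rpower delta nu).

(* Main.v *)
Require Import Defs.
From Stdlib Require Import Reals ZArith Lra Lia FunctionalExtensionality ClassicalEpsilon.
From HB Require Import structures.
From Coquelicot Require Import Coquelicot.
From mathcomp Require Import ssreflect ssrbool ssrfun eqtype ssrnat seq fintype bigop.
Local Open Scope R_scope.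

(** Write omega for the modulus of continuity of f.  A Kantorovich mean c_k over the cell of k
    satisfies |c_k - f(x)| <= omega(1/n) (2 + sum_m |n x_m - k_m|), so subtracting f(x) from all
    the c_k in the derivative of the quotient K_n f, and using that the integer-translate sums
    of phi, |x| phi, |phi'| and |x| |phi'| are bounded, gives the Bernstein-type inequality
    |d/dx_i K_n f| <= C n omega(1/n).  Here |x| phi is handled by the decay of sigma
    (alpha > 1), and |x| |phi'| by M_1(phi') < oo.  Comparing f with K_n f,
    omega(t) <= 2 C_0 n^(-nu) + C' t n omega(1/n), and iterating this along n_j = n_0 A^j with
    A large yields omega(t) = O(t^nu) because nu < 1. *)

(** Two features of the setting shape the proof. Since [Psi_sigma] is a product, a sum over a box of
    indices is a product of one-dimensional sums, and the weight |n x_m - k_m| falls on one factor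
    at a time; when it falls on the differentiated factor, the sum of |x| |phi'| appears, which is
    why M_1(phi') enters. The quotient also needs a denominator bounded away from 0 up to the
    boundary of I, where the index range is cut off: once every side of n I has length at least 3,
    some admissible index lies within distance 2 of n x in each coordinate, and phi is bounded below
    on [-2, 2] by concavity together with sigma(1) < 1. The modulus is handled as a predicate in the
    coordinatewise distance, which suits moves along one coordinate; the Euclidean modulus is
    recovered only at the end. *)

HB.instance Definition _ := Monoid.isComLaw.Build R 0 Rplus
  (fun x y z => esym (Rplus_assoc x y z)) Rplus_comm Rplus_0_l.
HB.instance Definition _ := Monoid.isComLaw.Build R 1 Rmult
  (fun x y z => esym (Rmult_assoc x y z)) Rmult_comm Rmult_1_l.

(** * Finite sums and products of real numbers *)

Lemma sum_distrl (T : Type) (s : seq T) (F : T -> R) (c : R) :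
  \big[Rplus/0]_(k <- s) (c * F k) = c * \big[Rplus/0]_(k <- s) F k.
Proof.
elim: s => [|k s IH]; first by rewrite !big_nil; ring.
by rewrite !big_cons IH; ring.
Qed.

Lemma sum_le (T : Type) (P : T -> Prop) (s : seq T) (F G : T -> R) :
  List.Forall P s -> (forall k, P k -> F k <= G k) ->
  \big[Rplus/0]_(k <- s) F k <= \big[Rplus/0]_(k <- s) G k.
Proof.
move=> Ps FG; elim: Ps => [|k r Pk _ IH]; first by rewrite !big_nil; lra.
by rewrite !big_cons; have := FG k Pk; lra.
Qed.

Lemma Forall_True (T : Type) (s : seq T) : List.Forall (fun _ => True) s.
Proof. by elim: s => [|k s IH]; constructor. Qed.

Lemma sum_le_all (T : Type) (s : seq T) (F G : T -> R) :
  (forall k, F k <= G k) ->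
  \big[Rplus/0]_(k <- s) F k <= \big[Rplus/0]_(k <- s) G k.
Proof. by move=> FG; apply: (sum_le _ _ s F G (Forall_True _ s)) => k _. Qed.

Lemma sum_ge0 (T : Type) (s : seq T) (F : T -> R) :
  (forall k, 0 <= F k) -> 0 <= \big[Rplus/0]_(k <- s) F k.
Proof.
move=> F0; elim: s => [|k s IH]; first by rewrite big_nil; lra.
by rewrite big_cons; have := F0 k; lra.
Qed.

Lemma sum_le_const (T : Type) (s : seq T) (F : T -> R) (c : R) :
  (forall k, F k <= c) -> \big[Rplus/0]_(k <- s) F k <= INR (size s) * c.
Proof.
move=> Fc; elim: s => [|k s IH]; first by rewrite big_nil /=; lra.
by rewrite big_cons [size _]/= S_INR; have := Fc k; lra.
Qed.

Lemma sum_ord_ge_term (d : nat) (F : 'I_d -> R) (i : 'I_d) :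
  (forall j, 0 <= F j) -> F i <= \big[Rplus/0]_(j < d) F j.
Proof.
move=> F0; rewrite (bigD1 i) //= -[X in X <= _]Rplus_0_r; apply: Rplus_le_compat_l.
by rewrite -big_filter; exact: sum_ge0.
Qed.

Lemma Rabs_sum_le (T : Type) (s : seq T) (F : T -> R) :
  Rabs (\big[Rplus/0]_(k <- s) F k) <= \big[Rplus/0]_(k <- s) Rabs (F k).
Proof.
elim: s => [|k s IH]; first by rewrite !big_nil Rabs_R0; lra.
by rewrite !big_cons; have := Rabs_triang (F k) (\big[Rplus/0]_(k <- s) F k); lra.
Qed.

Lemma is_derive_sum (T : Type) (s : seq T) (F dF : T -> R -> R) (x : R) :
  (forall k, is_derive (F k) x (dF k x)) ->
  is_derive (fun t => \big[Rplus/0]_(k <- s) F k t) x (\big[Rplus/0]_(k <- s) dF k x).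
Proof.
move=> D; elim: s => [|k s IH].
  rewrite big_nil; apply: (is_derive_ext (fun _ => 0)); first by move=> t; rewrite big_nil.
  exact: is_derive_const.
rewrite big_cons; apply: (is_derive_ext (fun t => F k t + \big[Rplus/0]_(j <- s) F j t)).
  by move=> t; rewrite big_cons.
exact: is_derive_plus.
Qed.

Lemma prod_ge0 (T : Type) (s : seq T) (F : T -> R) :
  (forall k, 0 <= F k) -> 0 <= \big[Rmult/1]_(k <- s) F k.
Proof.
move=> F0; elim: s => [|k s IH]; first by rewrite big_nil; lra.
by rewrite big_cons; apply: Rmult_le_pos.
Qed.

Lemma prod_le_pow (T : Type) (s : seq T) (F : T -> R) (B : R) :
  (forall k, 0 <= F k <= B) ->
  \big[Rmult/1]_(k <- s) F k <= B ^ size s.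
Proof.
move=> FB; elim: s => [|k s IH]; first by rewrite big_nil /=; lra.
rewrite big_cons; apply: Rmult_le_compat => //; try by case: (FB k).
by apply: prod_ge0 => j; case: (FB j).
Qed.

Lemma pow_le_prod (T : Type) (s : seq T) (F : T -> R) (m : R) :
  0 <= m -> (forall k, m <= F k) ->
  m ^ size s <= \big[Rmult/1]_(k <- s) F k.
Proof.
move=> m0 FB; elim: s => [|k s IH]; first by rewrite big_nil /=; lra.
have ? := pow_le m (size s) m0.
rewrite big_cons /=; have := FB k; nra.
Qed.

Lemma size_index_enum_ord (d : nat) : size (index_enum ('I_d)) = d.
Proof. by rewrite /index_enum unlock -enumT size_enum_ord. Qed.

(** * Sums over integer translates *)

Lemma sum_ZrangeE (F : Z -> R) (l h : Z) :
  \big[Rplus/0]_(k <- Zrange l h) F k =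
  \big[Rplus/0]_(0 <= j < Z.to_nat (h - l + 1)) F (l + Z.of_nat j)%Z.
Proof. by rewrite /Zrange big_map /index_iota subn0. Qed.

(** Padding with nonnegative terms. [M_beta] controls symmetric ranges only, whereas the operators
    sum over arbitrary ones. *)
Lemma sum_Zrange_le_sym (F : Z -> R) (l h : Z) :
  (forall k, 0 <= F k) ->
  exists N : nat, \big[Rplus/0]_(k <- Zrange l h) F k
     <= \big[Rplus/0]_(k <- Zrange (- Z.of_nat N) (Z.of_nat N)) F k.
Proof.
move=> F0; exists (Z.to_nat (Z.abs l + Z.abs h)).
set N := Z.to_nat _; rewrite !sum_ZrangeE.
case: (Z_lt_le_dec h l) => hl.
  have -> : Z.to_nat (h - l + 1) = 0%N by lia.
  rewrite big_nil; exact: sum_ge0.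
set n1 := Z.to_nat (l + Z.of_nat N); set n2 := Z.to_nat (h - l + 1).
have -> : Z.to_nat (Z.of_nat N - - Z.of_nat N + 1) = (n1 + n2 + Z.to_nat (Z.of_nat N - h))%N.
  rewrite -!plusE /n1 /n2; lia.
rewrite [X in _ <= X](@big_cat_nat _ _ _ (n1 + n2)%N) ?leq_addr //=.
rewrite [X in _ <= X + _](@big_cat_nat _ _ _ n1 0%N (n1 + n2)%N) ?leq_addr //=.
have -> : \big[Rplus/0]_(n1 <= j < n1 + n2) F (- Z.of_nat N + Z.of_nat j)%Z
   = \big[Rplus/0]_(0 <= j < n2) F (l + Z.of_nat j)%Z.
  rewrite -{1}[n1]add0n big_addn addKn.
  by apply: eq_bigr => j _; congr F; rewrite -plusE /n1; lia.
have P1 : 0 <= \big[Rplus/0]_(0 <= j < n1) F (- Z.of_nat N + Z.of_nat j)%Z by exact: sum_ge0.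
have := sum_ge0 _ (index_iota (n1 + n2) (n1 + n2 + Z.to_nat (Z.of_nat N - h)))
  (fun j => F (- Z.of_nat N + Z.of_nat j)%Z) (fun _ => F0 _).
lra.
Qed.

(** Stands for a uniform bound on the series of integer translates: uniformity in the point and in
    the finite range replaces any talk of convergence. *)
Definition shift_bounded (g : R -> R) : Prop :=
  exists B, forall u l h, \big[Rplus/0]_(k <- Zrange l h) g (u - IZR k) <= B.

Lemma shift_bounded_le (g g' : R -> R) :
  (forall x, g x <= g' x) -> shift_bounded g' -> shift_bounded g.
Proof.
move=> gg' [B HB]; exists B => u l h; apply: Rle_trans (HB u l h).
by apply: sum_le_all.
Qed.

Lemma shift_bounded_plus (g g' : R -> R) :
  shift_bounded g -> shift_bounded g' -> shift_bounded (fun x => g x + g' x).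
Proof.
move=> [B HB] [B' HB']; exists (B + B') => u l h.
by rewrite big_split /=; have := HB u l h; have := HB' u l h; lra.
Qed.

Lemma shift_bounded_scal (c : R) (g : R -> R) : 0 <= c ->
  shift_bounded g -> shift_bounded (fun x => c * g x).
Proof.
move=> c0 [B HB]; exists (c * B) => u l h.
by rewrite sum_distrl; apply: Rmult_le_compat_l.
Qed.

(* The sum over k telescopes in steps of two. *)
Lemma shift_bounded_increment (H : R -> R) (L U : R) :
  (forall x, L <= H x <= U) -> shift_bounded (fun x => H (x + 1) - H (x - 1)).
Proof.
move=> HLU; exists (2 * (U - L)) => u l h; rewrite sum_ZrangeE.
set N := Z.to_nat _; set v := u - IZR l.
have -> : \big[Rplus/0]_(0 <= j < N)
    (H (u - IZR (l + Z.of_nat j) + 1) - H (u - IZR (l + Z.of_nat j) - 1))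
  = H (v + 1) + H v - H (v - INR N + 1) - H (v - INR N).
  elim: N => [|N IH].
    by rewrite big_nil /= /Rminus Ropp_0 !Rplus_0_r; ring.
  rewrite big_nat_recr //= IH plus_IZR -INR_IZR_INZ -/(INR N.+1) S_INR /v.
  have -> : u - IZR l - (INR N + 1) + 1 = u - IZR l - INR N by ring.
  have -> : u - (IZR l + INR N) + 1 = u - IZR l - INR N + 1 by ring.
  have -> : u - (IZR l + INR N) - 1 = u - IZR l - (INR N + 1) by ring.
  ring.
have := HLU (v + 1); have := HLU v; have := HLU (v - INR N + 1).
have := HLU (v - INR N); lra.
Qed.

Lemma shift_bounded_opp (g : R -> R) :
  shift_bounded g -> shift_bounded (fun x => g (- x)).
Proof.
move=> [B HB]; exists B => u l h; apply: Rle_trans (HB (- u) (- h)%Z (- l)%Z).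
rewrite !sum_ZrangeE.
have -> : (- l - - h + 1 = h - l + 1)%Z by ring.
set N := Z.to_nat _.
rewrite big_nat_rev /=; apply: Req_le; apply: eq_big_nat => j /andP [_ /ltP jN].
congr g; rewrite add0n !plus_IZR opp_IZR -minusE -!INR_IZR_INZ minus_INR //.
have -> : INR N = IZR h - IZR l + 1; last by rewrite S_INR; lra.
rewrite INR_IZR_INZ Z2Nat.id; last by lia.
by rewrite plus_IZR minus_IZR.
Qed.

(** By monotonicity the increments of H at x and at -x are both nonnegative, and one of them is the
    increment at |x|; their sum dominates g, and each has bounded translate sums by telescoping. *)
Lemma shift_bounded_increment_abs (g H : R -> R) (L U : R) :
  (forall x, L <= H x <= U) -> (forall x y, x <= y -> H x <= H y) ->
  (forall x, g x <= H (Rabs x + 1) - H (Rabs x - 1)) -> shift_bounded g.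
Proof.
move=> HLU Hm gH.
have S1 := shift_bounded_increment H L U HLU.
apply: (shift_bounded_le _ (fun x => (H (x + 1) - H (x - 1)) + (H (- x + 1) - H (- x - 1)))).
  move=> x; have := gH x.
  have := Hm (x - 1) (x + 1); have := Hm (- x - 1) (- x + 1).
  by rewrite /Rabs; case: Rcase_abs => _; lra.
exact: shift_bounded_plus S1 (shift_bounded_opp _ S1).
Qed.

(** The ramp of slope 1/2, truncated at -1 and r + 1, gains exactly 1 over [|x| - 1, |x| + 1]
    whenever |x| <= r. *)
Lemma shift_bounded_indicator (r : R) : 0 <= r ->
  shift_bounded (fun x => if Rle_dec (Rabs x) r then 1 else 0).
Proof.
move=> r0.
apply: (shift_bounded_increment_abs _ (fun x => / 2 * Rmax (- 1) (Rmin x (r + 1))) (- 1) (r + 2)).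
- by move=> x; rewrite /Rmin; case: Rle_dec => ?; rewrite /Rmax; case: Rle_dec => ?; lra.
- by move=> x y xy; rewrite /Rmin; repeat (case: Rle_dec => ?); rewrite /Rmax; repeat (case: Rle_dec => ?); lra.
move=> x; have := Rabs_pos x.
by case: Rle_dec => ?; rewrite /Rmin; repeat (case: Rle_dec => ?); rewrite /Rmax; repeat (case: Rle_dec => ?); rewrite /=; lra.
Qed.

Lemma shift_bounded_M_beta (g : R -> R) :
  Rbar_lt (M_beta 1 g) p_infty -> shift_bounded (fun x => Rabs (g x) * Rabs x).
Proof.
rewrite /M_beta; set E := fun r => _.
have [ub _] := Lub_Rbar_correct E; move=> fin.
have [B HB] : exists B : R, forall r, E r -> r <= B.
  case: (Lub_Rbar E) ub fin => [B|//|] ub _; first by exists B.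
  by exists 0 => r /ub.
exists B => u l h.
have [|N HN] := sum_Zrange_le_sym (fun k => Rabs (g (u - IZR k)) * Rabs (u - IZR k)) l h.
  by move=> k; apply: Rmult_le_pos; exact: Rabs_pos.
apply: Rle_trans HN _; apply: HB; exists u, N.
by apply: eq_bigr => k _; rewrite /= Rmult_1_r (Rabs_minus_sym u).
Qed.

(** * The kernel generated by a sigmoidal function *)

Lemma sigmoid_bounds (sigma : R -> R) :
  (forall x y, x <= y -> sigma x <= sigma y) ->
  is_lim sigma m_infty 0 -> is_lim sigma p_infty 1 ->
  forall x, 0 <= sigma x <= 1.
Proof.
move=> Hmono Hm Hp x; split.
  apply: (is_lim_le_loc sigma (fun _ => sigma x) m_infty 0 (sigma x)) => //.
    by exists x => y yx; apply: Hmono; lra.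
  exact: is_lim_const.
apply: (is_lim_le_loc (fun _ => sigma x) sigma p_infty (sigma x) 1) => //.
  by exists x => y yx; apply: Hmono; lra.
exact: is_lim_const.
Qed.

(** If sigma y <= sigma x, then concavity on [x, z] gives sigma z <= sigma x for every z > y, and
    the limit 1 at infinity would be at most sigma x. *)
Lemma concave_sigmoid_lt (sigma : R -> R) :
  (forall x y t, 0 <= x -> 0 <= y -> 0 <= t <= 1 ->
     t * sigma x + (1 - t) * sigma y <= sigma (t * x + (1 - t) * y)) ->
  is_lim sigma p_infty 1 ->
  forall x y, 0 <= x < y -> sigma x < 1 -> sigma x < sigma y.
Proof.
move=> Hconc Hp x y xy x1; case: (Rlt_le_dec (sigma x) (sigma y)) => // yx; exfalso.
suff : Rbar_le 1 (sigma x) by rewrite /=; lra.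
apply: (is_lim_le_loc sigma (fun _ => sigma x) p_infty 1 (sigma x)) => //; last by exact: is_lim_const.
exists y => z yz.
have zx : 0 < z - x by lra.
have t01 : 0 <= (z - y) / (z - x) <= 1.
  split; first by apply: Rdiv_le_0_compat; lra.
  by apply/Rle_div_l; lra.
have s0 : 0 < 1 - (z - y) / (z - x).
  have -> : 1 - (z - y) / (z - x) = (y - x) / (z - x) by field; lra.
  by apply: Rdiv_lt_0_compat; lra.
have := Hconc x z _ (proj1 xy) _ t01.
have -> : (z - y) / (z - x) * x + (1 - (z - y) / (z - x)) * z = y by field; lra.
move=> /(_ ltac:(lra)); nra.
Qed.

Lemma phi_sigma_ge0 (sigma : R -> R) :
  (forall x y, x <= y -> sigma x <= sigma y) -> forall x, 0 <= phi_sigma sigma x.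
Proof. by move=> Hmono x; rewrite /phi_sigma; have := Hmono (x - 1) (x + 1); lra. Qed.

Lemma phi_sigma_even (sigma : R -> R) :
  (forall x, sigma (- x) - / 2 = - (sigma x - / 2)) ->
  forall x, phi_sigma sigma (Rabs x) = phi_sigma sigma x.
Proof.
move=> Hodd x; rewrite /Rabs; case: Rcase_abs => // _; rewrite /phi_sigma.
have := Hodd (x - 1); have := Hodd (x + 1).
have -> : - (x + 1) = - x - 1 by ring.
have -> : - (x - 1) = - x + 1 by ring.
lra.
Qed.

(** By evenness take x >= 0. The interval [x - 1, x + 1] contains [1, 2] if 1 <= x <= 2 and [0, 1]
    if x < 1; sigma increases strictly over both, since sigma 0 = 1/2 and sigma 1 are below 1. *)
Lemma phi_sigma_pos (sigma : R -> R) :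
  (forall x y, x <= y -> sigma x <= sigma y) ->
  (forall x, sigma (- x) - / 2 = - (sigma x - / 2)) ->
  (forall x y, 0 <= x < y -> sigma x < 1 -> sigma x < sigma y) ->
  sigma 1 < 1 ->
  exists2 m, 0 < m & forall x, Rabs x <= 2 -> m <= phi_sigma sigma x.
Proof.
move=> Hmono Hodd Hlt Hs1.
have s0 : sigma 0 = / 2 by have := Hodd 0; rewrite Ropp_0; lra.
have h01 := Hlt 0 1 ltac:(lra) ltac:(lra).
have h12 := Hlt 1 2 ltac:(lra) Hs1.
exists (/ 2 * Rmin (sigma 2 - sigma 1) (sigma 1 - sigma 0)).
  by apply: Rmult_lt_0_compat; [lra | apply: Rmin_pos; lra].
move=> x x2; rewrite -phi_sigma_even // /phi_sigma; have x0 := Rabs_pos x.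
apply: Rmult_le_compat_l; first by lra.
case: (Rle_lt_dec 1 (Rabs x)) => x1.
  have := Rmin_l (sigma 2 - sigma 1) (sigma 1 - sigma 0).
  by have := Hmono 2 (Rabs x + 1); have := Hmono (Rabs x - 1) 1; lra.
have := Rmin_r (sigma 2 - sigma 1) (sigma 1 - sigma 0).
by have := Hmono 1 (Rabs x + 1); have := Hmono (Rabs x - 1) 0; lra.
Qed.

Lemma shift_bounded_phi_sigma (sigma : R -> R) :
  (forall x, 0 <= sigma x <= 1) -> shift_bounded (phi_sigma sigma).
Proof.
by move=> H; apply: shift_bounded_scal; [lra | exact: shift_bounded_increment H].
Qed.

Lemma Rpower_decr (p x y : R) : p <= 0 -> 0 < x <= y -> Rpower y p <= Rpower x p.
Proof.
move=> p0 [x0 xy]; rewrite /Rpower.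
have lnxy : ln x <= ln y by case: xy => [|<-]; [move=> /(ln_increasing _ _ x0)|]; lra.
have : p * ln y <= p * ln x by nra.
by case=> [/exp_increasing|->]; lra.
Qed.

(** Mean value theorem for z^(1 - alpha) on [y - 2, y - 1]: its slope is smallest in absolute value
    at the right end. *)
Lemma Rpower_integral_test (alpha y : R) : 1 < alpha -> 2 < y ->
  (alpha - 1) * Rpower (y - 1) (- alpha)
     <= Rpower (y - 2) (1 - alpha) - Rpower (y - 1) (1 - alpha).
Proof.
move=> a1 y2.
have D x : 0 < x -> is_derive (fun z => Rpower z (1 - alpha)) x ((1 - alpha) * Rpower x (- alpha)).
  move=> x0; apply/is_derive_Reals.
  have := derivable_pt_lim_power x (1 - alpha) x0.
  by have -> : 1 - alpha - 1 = - alpha by ring.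
have mn : Rmin (y - 2) (y - 1) = y - 2 by apply: Rmin_left; lra.
have mx : Rmax (y - 2) (y - 1) = y - 1 by apply: Rmax_right; lra.
have [||c [cb E]] := MVT_gen (fun z => Rpower z (1 - alpha)) (y - 2) (y - 1)
    (fun x => (1 - alpha) * Rpower x (- alpha)); rewrite ?mn ?mx.
- by move=> x xb; apply: D; lra.
- move=> x xb; apply/continuity_pt_filterlim; exact: (ex_derive_continuous (fun z => Rpower z (1 - alpha)) x (ex_intro _ _ (D x ltac:(lra)))).
move: cb; rewrite mn mx => cb.
have := Rpower_decr (- alpha) c (y - 1) ltac:(lra) ltac:(lra).
have -> : Rpower (y - 2) (1 - alpha) - Rpower (y - 1) (1 - alpha)
   = (alpha - 1) * Rpower c (- alpha) by lra.
by move=> H; apply: Rmult_le_compat_l; lra.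
Qed.

Lemma shift_bounded_Rpower_tail (alpha : R) : 1 < alpha ->
  shift_bounded (fun x => if Rle_dec 3 (Rabs x) then Rpower (Rabs x - 1) (- alpha) else 0).
Proof.
move=> a1.
(* An antiderivative of (z - 1)^(-alpha), frozen below z = 2. It is bounded because alpha > 1, so
   its increments telescope to a bounded sum. *)
pose T z := - (/ (alpha - 1) * Rpower (Rmax (z - 1) 1) (1 - alpha)).
have p0 : 0 < / (alpha - 1) by apply: Rinv_0_lt_compat; lra.
have Tmono x y : x <= y -> T x <= T y.
  move=> xy; apply: Ropp_le_contravar; apply: Rmult_le_compat_l; first by lra.
  apply: Rpower_decr; first by lra.
  have := Rmax_r (x - 1) 1.
  by have := Rmax_lub (x - 1) 1 (Rmax (y - 1) 1); have := Rmax_r (y - 1) 1;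
     have := Rmax_l (y - 1) 1; lra.
apply: (shift_bounded_increment_abs _ T (- / (alpha - 1)) 0) => //.
  move=> x; rewrite /T.
  have := Rpower_decr (1 - alpha) 1 (Rmax (x - 1) 1) ltac:(lra) (conj Rlt_0_1 (Rmax_r _ _)).
  rewrite {2}/Rpower ln_1 Rmult_0_r exp_0.
  have : 0 < Rpower (Rmax (x - 1) 1) (1 - alpha) by exact: exp_pos.
  by split; nra.
move=> x; case: Rle_dec => x3 /=; last by have := Tmono (Rabs x - 1) (Rabs x + 1); lra.
have TE z : 2 <= z -> T z = - (/ (alpha - 1) * Rpower (z - 1) (1 - alpha)).
  by move=> z2; rewrite /T Rmax_left //; lra.
apply: (Rle_trans _ (T (Rabs x) - T (Rabs x - 1))); last first.
  by have := Tmono (Rabs x) (Rabs x + 1); lra.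
rewrite !TE; try lra.
have -> : Rabs x - 1 - 1 = Rabs x - 2 by ring.
have := Rpower_integral_test alpha (Rabs x) a1 ltac:(lra) => H.
apply: (Rmult_le_reg_l (alpha - 1)); first by lra.
apply: Rle_trans H _; apply: Req_le; field; lra.
Qed.

(** For y = |x| large, phi(y) <= (1 - sigma(y - 1)) / 2 = sigma(1 - y) / 2 by oddness. The decay of
    sigma and y <= 2 (y - 1) then give y phi(y) <= |C| (y - 1)^(-alpha), whose translates are
    summable for alpha > 1. *)
Lemma shift_bounded_phi_sigma_moment (sigma : R -> R) (alpha : R) :
  (forall x, 0 <= sigma x <= 1) ->
  (forall x, sigma (- x) - / 2 = - (sigma x - / 2)) ->
  1 < alpha ->
  (exists C M, forall x, x < M -> Rabs (sigma x) <= C * Rpower (Rabs x) (- 1 - alpha)) ->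
  shift_bounded (fun x => phi_sigma sigma x * Rabs x).
Proof.
move=> Hb Hodd a1 [C [M HC]].
(* Chosen so that |x| > r implies both |x| >= 3 and 1 - |x| < M, where the decay hypothesis
   applies. *)
pose r := 3 + Rabs M.
have r3 : 3 <= r by have := Rabs_pos M; rewrite /r; lra.
have C0 : 0 <= Rabs C by exact: Rabs_pos.
apply: (shift_bounded_le _ (fun x =>
   r * (if Rle_dec (Rabs x) r then 1 else 0)
   + Rabs C * (if Rle_dec 3 (Rabs x) then Rpower (Rabs x - 1) (- alpha) else 0))); last first.
  apply: shift_bounded_plus; apply: shift_bounded_scal => //; try lra.
    by apply: shift_bounded_indicator; lra.
  exact: shift_bounded_Rpower_tail.
move=> x; have x0 := Rabs_pos x; rewrite -phi_sigma_even //.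
set y := Rabs x in x0 *.
have P0 : 0 < Rpower (y - 1) (- alpha) by exact: exp_pos.
have := Hb (y + 1); have := Hb (y - 1); rewrite /phi_sigma => b1 b2.
case: (Rle_dec y r) => yr /=.
  have : 0 <= Rabs C * (if Rle_dec 3 y then Rpower (y - 1) (- alpha) else 0).
    by apply: Rmult_le_pos => //; case: Rle_dec => ? /=; lra.
  nra.
case: Rle_dec => y3 /=; last by lra.
have yM : 1 - y < M.
  by have := Rle_abs (- M); rewrite Rabs_Ropp; rewrite /r in yr; lra.
have := HC (1 - y) yM.
have -> : Rabs (1 - y) = y - 1 by rewrite Rabs_minus_sym Rabs_pos_eq; lra.
have -> : - 1 - alpha = - alpha + - (1) by ring.
rewrite Rpower_plus (Rpower_Ropp _ 1) Rpower_1; last by lra.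
move=> H.
have H1 : 1 - sigma (y - 1) <= Rabs C * Rpower (y - 1) (- alpha) * / (y - 1).
  have := Hodd (y - 1); have -> : - (y - 1) = 1 - y by ring.
  move=> E; have := Rle_abs (sigma (1 - y)).
  have : C * (Rpower (y - 1) (- alpha) * / (y - 1))
     <= Rabs C * (Rpower (y - 1) (- alpha) * / (y - 1)).
    apply: Rmult_le_compat_r; last by exact: Rle_abs.
    apply: Rmult_le_pos; first by lra.
    by apply: Rlt_le; apply: Rinv_0_lt_compat; lra.
  lra.
have H2 : (1 - sigma (y - 1)) * (y - 1) <= Rabs C * Rpower (y - 1) (- alpha).
  apply: (Rle_trans _ (Rabs C * Rpower (y - 1) (- alpha) * / (y - 1) * (y - 1))).
    by apply: Rmult_le_compat_r; lra.
  by apply: Req_le; field; lra.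
nra.
Qed.

Lemma Derive_phi_sigma (sigma : R -> R) : (forall x : R, ex_derive sigma x) ->
  forall x : R, is_derive (phi_sigma sigma) x (Derive (phi_sigma sigma) x) /\
    Derive (phi_sigma sigma) x = / 2 * (Derive sigma (x + 1) - Derive sigma (x - 1)).
Proof.
move=> D x.
have H : is_derive (phi_sigma sigma) x (/ 2 * (Derive sigma (x + 1) - Derive sigma (x - 1))).
  rewrite /phi_sigma; auto_derive; last by rewrite !Rmult_1_l.
  by split; [exact: D | split; [exact: D|]].
by rewrite (is_derive_unique _ _ _ H).
Qed.

(** Outside [-1, 1] the weight |x| is at least 1; on [-1, 1] the continuous function phi' is bounded
    and an indicator suffices. *)
Lemma shift_bounded_Derive_phi_sigma (sigma : R -> R) :
  (forall x, ex_derive sigma x) -> (forall x, ex_derive (Derive sigma) x) ->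
  shift_bounded (fun x => Rabs (Derive (phi_sigma sigma) x) * Rabs x) ->
  shift_bounded (fun x => Rabs (Derive (phi_sigma sigma) x)).
Proof.
move=> HC1 HC2 HM.
have [|K HK] := bounded_continuity (V := R_NormedModule) (Derive (phi_sigma sigma)) (- 1) 1.
  move=> x _.
  apply: (continuous_ext (fun x => / 2 * (Derive sigma (x + 1) - Derive sigma (x - 1)))).
    by move=> y; rewrite (proj2 (Derive_phi_sigma sigma HC1 y)).
  apply: (ex_derive_continuous (V := R_NormedModule)).
  by auto_derive; split; [exact: HC2 | split; [exact: HC2|]].
have K0 : 0 <= K.
  have := HK 0 ltac:(lra); rewrite /norm /= /abs /= => H.
  by have := Rabs_pos (Derive (phi_sigma sigma) 0); lra.
apply: (shift_bounded_le _ (fun x => K * (if Rle_dec (Rabs x) 1 then 1 else 0)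
    + Rabs (Derive (phi_sigma sigma) x) * Rabs x)); last first.
  apply: shift_bounded_plus => //; apply: shift_bounded_scal => //.
  by apply: shift_bounded_indicator; lra.
move=> x; have P := Rabs_pos (Derive (phi_sigma sigma) x); have Px := Rabs_pos x.
case: Rle_dec => x1 /=; last by nra.
have : Rabs (Derive (phi_sigma sigma) x) < K.
  by apply: HK; apply/Rabs_le_between.
nra.
Qed.

(** * Sums over boxes of multi-indices *)

(** [box_idx] with an arbitrary list in place of [enum 'I_d], so that induction on the list is
    possible. *)
Definition box_idx_on {d : nat} (lo hi : 'I_d -> Z) (s : seq 'I_d) : seq ('I_d -> Z) :=
  foldr (fun i acc =>
           flatten (map (fun k => map (fun j => upd k i j) (Zrange (lo i) (hi i))) acc))
        [:: fun _ => 0%Z] s.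

Lemma upd_eq (T : Type) (d : nat) (x : 'I_d -> T) (i : 'I_d) (t : T) : upd x i t i = t.
Proof. by rewrite /upd eqxx. Qed.

Lemma upd_neq (T : Type) (d : nat) (x : 'I_d -> T) (i j : 'I_d) (t : T) :
  j != i -> upd x i t j = x j.
Proof. by rewrite /upd => /negbTE ->. Qed.

Lemma upd_id (T : Type) (d : nat) (x : 'I_d -> T) (i : 'I_d) : upd x i (x i) = x.
Proof.
by apply: functional_extensionality => j; rewrite /upd; case: eqP => [->|].
Qed.

(** Distributivity. Since i does not occur in the rest of the list, updating coordinate i leaves the
    other factors unchanged. *)
Lemma sum_box_idx_on (d : nat) (lo hi : 'I_d -> Z) (s : seq 'I_d) (F : 'I_d -> Z -> R) :
  uniq s ->
  \big[Rplus/0]_(k <- box_idx_on lo hi s) \big[Rmult/1]_(i <- s) F i (k i)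
  = \big[Rmult/1]_(i <- s) \big[Rplus/0]_(j <- Zrange (lo i) (hi i)) F i j.
Proof.
elim: s => [|i s IH] /=; first by rewrite big_seq1 !big_nil.
move=> /andP [is_ us]; rewrite big_flatten big_map big_cons -IH // -sum_distrl.
apply: eq_bigr => k _; rewrite big_map Rmult_comm -sum_distrl.
apply: eq_bigr => j _; rewrite big_cons upd_eq Rmult_comm; congr (_ * _).
rewrite !big_seq; apply: eq_bigr => m ms; rewrite upd_neq //.
by apply: contraNneq is_ => <-.
Qed.

Lemma prod_index_enum (d : nat) (F : 'I_d -> R) :
  \big[Rmult/1]_(i < d) F i = \big[Rmult/1]_(i <- enum 'I_d) F i.
Proof. by rewrite big_enum. Qed.

Lemma sum_box_idx (d : nat) (lo hi : 'I_d -> Z) (F : 'I_d -> Z -> R) :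
  \big[Rplus/0]_(k <- box_idx lo hi) \big[Rmult/1]_(i < d) F i (k i)
  = \big[Rmult/1]_(i < d) \big[Rplus/0]_(j <- Zrange (lo i) (hi i)) F i j.
Proof.
rewrite prod_index_enum -sum_box_idx_on ?enum_uniq //.
by apply: eq_bigr => k _; rewrite prod_index_enum.
Qed.

Lemma Forall_Zrange (l h : Z) : List.Forall (fun j => (l <= j <= h)%Z) (Zrange l h).
Proof.
apply/List.Forall_forall => j /List.in_map_iff [m [<-]] H.
have E s : List.In m s -> m \in s.
  by elim: s => [|n s IH] //= [->|/IH]; rewrite inE ?eqxx // => ->; rewrite orbT.
by move: (E _ H); rewrite mem_iota add0n => /ltP; lia.
Qed.

Lemma Forall_box_idx (d : nat) (lo hi : 'I_d -> Z) :
  List.Forall (fun k => forall i, (lo i <= k i <= hi i)%Z) (box_idx lo hi).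
Proof.
have E s : List.Forall (fun k => forall i, i \in s -> (lo i <= k i <= hi i)%Z)
    (box_idx_on lo hi s).
  elim: s => [|i s IH] /=; first by constructor.
  elim: IH => [|k r Pk _ IHr] /=; first by constructor.
  apply/List.Forall_app; split=> //; apply/List.Forall_map.
  apply: List.Forall_impl (Forall_Zrange (lo i) (hi i)) => j jb m.
  rewrite inE /upd; case: eqP => [->|_] //= ms; exact: Pk.
apply: List.Forall_impl (E (enum 'I_d)) => k Pk i.
by apply: Pk; rewrite mem_enum.
Qed.

Lemma sum_Zrange_ge_term (l h k : Z) (F : Z -> R) :
  (forall j, 0 <= F j) -> (l <= k <= h)%Z ->
  F k <= \big[Rplus/0]_(j <- Zrange l h) F j.
Proof.
move=> F0 klh; rewrite /Zrange big_map.
have : Z.to_nat (k - l) \in iota 0 (Z.to_nat (h - l + 1)).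
  by rewrite mem_iota add0n; apply/ltP; lia.
have {2}-> : k = (l + Z.of_nat (Z.to_nat (k - l)))%Z by lia.
elim: (iota _ _) => [//|m s IH]; rewrite inE big_cons.
have := sum_ge0 _ s (fun j => F (l + Z.of_nat j)%Z) (fun j => F0 _).
case: eqP => [<- S0 _|_ S0 /= /IH]; first by lra.
by have := F0 (l + Z.of_nat m)%Z; lra.
Qed.

(** Expanding the weight gives twice the plain product plus d products in which only the m-th factor
    carries |u_m - k_m|; each sums to a product of d one-dimensional sums bounded by B. The kernel q
    may vary with the coordinate so that one of them can be |phi'|. *)
Lemma moment_sum_le (d : nat) (q : 'I_d -> R -> R) (B : R) (u : 'I_d -> R)
    (lo hi : 'I_d -> Z) :
  1 <= B -> (forall j v, 0 <= q j v) ->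
  (forall j v l h, \big[Rplus/0]_(k <- Zrange l h) q j (v - IZR k) <= B) ->
  (forall j v l h,
     \big[Rplus/0]_(k <- Zrange l h) (q j (v - IZR k) * Rabs (v - IZR k)) <= B) ->
  \big[Rplus/0]_(k <- box_idx lo hi)
     ((2 + \big[Rplus/0]_(m < d) Rabs (u m - IZR (k m)))
      * \big[Rmult/1]_(j < d) q j (u j - IZR (k j)))
  <= (2 + INR d) * B ^ d.
Proof.
move=> B1 q0 q1 q2.
have PB (G : 'I_d -> Z -> R) : (forall j k, 0 <= G j k) ->
   (forall j l h, \big[Rplus/0]_(k <- Zrange l h) G j k <= B) ->
   \big[Rplus/0]_(k <- box_idx lo hi) \big[Rmult/1]_(j < d) G j (k j) <= B ^ d.
  move=> G0 GB; rewrite sum_box_idx -[X in B ^ X](size_index_enum_ord d).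
  by apply prod_le_pow => j; split; [exact: sum_ge0 | exact: GB].
rewrite (eq_bigr (fun k : 'I_d -> Z =>
     2 * (\big[Rmult/1]_(j < d) q j (u j - IZR (k j)))
   + \big[Rplus/0]_(m < d)
       \big[Rmult/1]_(j < d) (if j == m then q j (u j - IZR (k j)) * Rabs (u j - IZR (k j))
                              else q j (u j - IZR (k j))))); last first.
  move=> k _; rewrite Rmult_plus_distr_r; congr (_ + _).
  rewrite Rmult_comm -sum_distrl; apply: eq_bigr => m _.
  rewrite (bigD1 m) //= [RHS](bigD1 m) //= eqxx.
  rewrite [in RHS](eq_bigr (fun j => q j (u j - IZR (k j)))); first by ring.
  by move=> j /negbTE ->.
rewrite big_split /= sum_distrl exchange_big /= Rmult_plus_distr_r.
apply: Rplus_le_compat.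
  by apply: Rmult_le_compat_l; [lra | apply: (PB (fun j k => q j (u j - IZR k)))].
rewrite -[X in INR X * _](size_index_enum_ord d); apply sum_le_const => m.
apply: (PB (fun j k => if j == m then q j (u j - IZR k) * Rabs (u j - IZR k)
   else q j (u j - IZR k))) => [j k|j l h]; case: (j == m) => //.
by apply: Rmult_le_pos => //; exact: Rabs_pos.
Qed.

(** * Lower bound for the denominator of the operator *)

Lemma Zfloor_spec (x : R) : IZR (Zfloor x) <= x < IZR (Zfloor x) + 1.
Proof. by rewrite /Zfloor minus_IZR; have := archimed x; lra. Qed.

Lemma Zceil_spec (x : R) : IZR (Zceil x) - 1 < x <= IZR (Zceil x).
Proof. by rewrite /Zceil opp_IZR; have := Zfloor_spec (- x); lra. Qed.

(** The index is the floor of u, clamped to the admissible range, which is nonempty because y - x >=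
    3. The distance 2 comes from the right end: floor y - 1 may lie almost 2 below y. *)
Lemma near_index (x y u : R) : 3 <= y - x -> x <= u <= y ->
  exists k, (Zceil x <= k <= Zfloor y - 1)%Z /\ Rabs (u - IZR k) <= 2.
Proof.
move=> xy xuy.
have cx := Zceil_spec x; have fy := Zfloor_spec y; have fu := Zfloor_spec u.
have le_cf : (Zceil x <= Zfloor y - 1)%Z.
  by apply: le_IZR; rewrite minus_IZR; lra.
case: (Z_lt_le_dec (Zfloor u) (Zceil x)) => [uc|cu].
  exists (Zceil x); split; first by lia.
  have : IZR (Zfloor u) <= IZR (Zceil x - 1) by apply: IZR_le; lia.
  by rewrite minus_IZR => ?; apply: Rabs_le; lra.
case: (Z_lt_le_dec (Zfloor y - 1) (Zfloor u)) => [yu|uy].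
  exists (Zfloor y - 1)%Z; split; first by lia.
  have : IZR (Zfloor y - 1 + 1) <= IZR (Zfloor u) by apply: IZR_le; lia.
  by rewrite plus_IZR minus_IZR => ?; apply: Rabs_le; lra.
exists (Zfloor u); split; first by lia.
by apply: Rabs_le; lra.
Qed.

(** The sum factors over the coordinates, and in each one-dimensional sum a single term near u_i is
    kept. *)
Lemma sum_Psi_ge (d : nat) (sigma : R -> R) (m : R) (x y u : 'I_d -> R) :
  (forall v, 0 <= phi_sigma sigma v) -> 0 <= m ->
  (forall v, Rabs v <= 2 -> m <= phi_sigma sigma v) ->
  (forall i, 3 <= y i - x i) -> (forall i, x i <= u i <= y i) ->
  m ^ d <= \big[Rplus/0]_(k <- box_idx (fun i => Zceil (x i)) (fun i => (Zfloor (y i) - 1)%Z))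
     Psi_sigma sigma (fun i => u i - IZR (k i)).
Proof.
move=> phi0 m0 phim xy xuy; rewrite /Psi_sigma.
rewrite (sum_box_idx d _ _ (fun i k => phi_sigma sigma (u i - IZR k))).
rewrite -{1}(size_index_enum_ord d); apply: pow_le_prod => // i.
have [k [kb uk]] := near_index (x i) (y i) (u i) (xy i) (xuy i).
apply: Rle_trans (phim _ uk) _.
exact: (sum_Zrange_ge_term _ _ k (fun k => phi_sigma sigma (u i - IZR k))).
Qed.

(** * Modulus of continuity on the box *)

(** A predicate rather than a supremum, which avoids extended reals. The Euclidean distance
    dominates every coordinate difference, so a bound of this kind also bounds [omega]. *)
Definition modulus_le {d : nat} (a b : 'I_d -> R) (f : ('I_d -> R) -> R) (delta E : R) : Prop :=
  forall x y, inI a b x -> inI a b y -> (forall i, Rabs (x i - y i) <= delta) ->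
    Rabs (f x - f y) <= E.

Lemma Rabs_le_dist2 (d : nat) (x y : 'I_d -> R) (i : 'I_d) : Rabs (x i - y i) <= dist2 x y.
Proof.
rewrite -(sqrt_Rsqr_abs (x i - y i)); apply: sqrt_le_1_alt; rewrite Rsqr_pow2.
apply: (sum_ord_ge_term d (fun j => (x j - y j) ^ 2)) => j; exact: pow2_ge_0.
Qed.

Lemma dist2_lt (d : nat) (x y : 'I_d -> R) (delta : R) : 0 < delta ->
  (forall i, Rabs (x i - y i) <= delta / (INR d + 1)) -> dist2 x y < delta.
Proof.
move=> d0 H; have nd := pos_INR d.
rewrite -[X in _ < X]sqrt_pow2; last by lra.
apply: sqrt_lt_1_alt; split; first by apply: sum_ge0 => k; exact: pow2_ge_0.
have := sum_le_const _ (index_enum ('I_d)) (fun i => (x i - y i) ^ 2) ((delta / (INR d + 1)) ^ 2).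
rewrite size_index_enum_ord => HS.
apply: (Rle_lt_trans _ (INR d * (delta / (INR d + 1)) ^ 2)).
  apply: HS => i; apply: pow_maj_Rabs; exact: H.
have -> : delta ^ 2 = (INR d + 1) ^ 2 * (delta / (INR d + 1)) ^ 2 by field; lra.
apply: Rmult_lt_compat_r; last by nra.
by apply: pow_lt; apply: Rdiv_lt_0_compat; lra.
Qed.

(* One coordinate at a time: Cousin's lemma in coordinate i removes the requirement that
   the i-th coordinate of y be close to that of x. *)
Lemma unif_cont_on_I (d : nat) (a b : 'I_d -> R) (f : ('I_d -> R) -> R) :
  (forall i, a i <= b i) -> cont_on_I a b f ->
  forall eps, 0 < eps -> exists2 delta, 0 < delta & modulus_le a b f delta eps.
Proof.
move=> Hab Hf eps eps0.
pose near (s : seq 'I_d) (x : 'I_d -> R) (delta : R) :=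
  forall y z, inI a b y -> inI a b z -> (forall j, j \notin s -> Rabs (y j - x j) < delta) ->
    (forall j, Rabs (y j - z j) < delta) -> Rabs (f y - f z) < eps.
have H s : forall x, inI a b x -> exists delta : posreal, near s x delta.
  elim: s => [|i s IH] x Ix.
    have [dl [dl0 Hdl]] := Hf x Ix (eps / 2) ltac:(lra).
    have nd := pos_INR d.
    have p0 : 0 < dl / (INR d + 1) / 2 by repeat apply: Rdiv_lt_0_compat; lra.
    exists (mkposreal _ p0) => y z Iy Iz /= yx yz.
    have fy : Rabs (f y - f x) < eps / 2.
      apply: Hdl => //; apply: dist2_lt => // j.
      by rewrite Rabs_minus_sym; have := yx j isT; lra.
    have fz : Rabs (f z - f x) < eps / 2.
      apply: Hdl => //; apply: dist2_lt => // j; rewrite Rabs_minus_sym.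
      have := Rabs_triang (z j - y j) (y j - x j); rewrite (Rabs_minus_sym (z j)).
      have -> : z j - y j + (y j - x j) = z j - x j by ring.
      by have := yx j isT; have := yz j; lra.
    have := Rabs_triang (f y - f x) (f x - f z); rewrite (Rabs_minus_sym (f x)).
    have -> : f y - f x + (f x - f z) = f y - f z by ring.
    by lra.
  have ex t : exists dl : posreal, a i <= t <= b i -> near s (upd x i t) dl.
    case: (Rle_dec (a i) t) => ta; last by exists (mkposreal 1 Rlt_0_1); lra.
    case: (Rle_dec t (b i)) => tb; last by exists (mkposreal 1 Rlt_0_1); lra.
    have [|dl Hdl] := IH (upd x i t); last by exists dl.
    by move=> j; rewrite /upd; case: eqP => [->|].
  pose dl t := proj1_sig (constructive_indefinite_description _ (ex t)).
  have Hdl t : a i <= t <= b i -> near s (upd x i t) (dl t).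
    by rewrite /dl; case: constructive_indefinite_description.
  (* The gauge [dl] yields one [dd] such that, up to a double negation, each point of [a_i, b_i] is
     within [dl t] of some t with [dd <= dl t]. *)
  have [dd Hdd] := compactness_value_1d (a i) (b i) dl.
  exists dd => y z Iy Iz yx yz; apply: NNPP => nf; apply: (Hdd (y i) (Iy i)) => -[t [tab [yt dt]]].
  apply: nf; apply: (Hdl t tab) => // j; last by have := yz j; lra.
  move=> js; rewrite /upd; case: eqP => [->//|/eqP ji].
  by have := yx j; rewrite inE negb_or ji js => /(_ isT); lra.
(* With every coordinate freed the base point is immaterial; the corner [a] is a convenient point of
   I. *)
have [dl Hdl] := H (enum 'I_d) a (fun i => conj (Rle_refl _) (Hab i)).
exists (dl / 2); first by have := cond_pos dl; lra.
move=> y z Iy Iz yz; apply: Rlt_le; apply: Hdl => // j; first by rewrite mem_enum.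
by have := yz j; have := cond_pos dl; lra.
Qed.

(** I is convex: the segment from x to y is cut into equal pieces, here by splitting off the first
    one. *)
Lemma modulus_le_chain (d : nat) (a b : 'I_d -> R) (f : ('I_d -> R) -> R) (delta E : R) (N : nat) :
  modulus_le a b f delta E -> modulus_le a b f (INR N.+1 * delta) (INR N.+1 * E).
Proof.
move=> H; elim: N => [|N IH]; first by rewrite /= !Rmult_1_l.
move=> x y Ix Iy xy.
have N0 : 0 < INR N.+1 by apply: lt_0_INR; apply/ltP.
pose t := / INR N.+2.
have t0 : 0 < t by apply: Rinv_0_lt_compat; apply: lt_0_INR; apply/ltP.
have tN : t * (INR N.+1 + 1) = 1.
  by rewrite -S_INR /t Rinv_l //; apply: Rgt_not_eq; apply: lt_0_INR; apply/ltP.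
pose z i := x i + t * (y i - x i).
have t1 : t <= 1 by nra.
have Iz : inI a b z by move=> i; have := Ix i; have := Iy i; rewrite /z; nra.
have H1 : Rabs (f x - f z) <= E.
  apply: H => // i; have -> : x i - z i = t * (x i - y i) by rewrite /z; ring.
  rewrite Rabs_mult Rabs_pos_eq; last by lra.
  have := Rmult_le_compat_l t _ _ (Rlt_le _ _ t0) (xy i).
  by rewrite (S_INR N.+1) -Rmult_assoc tN Rmult_1_l.
have H2 : Rabs (f z - f y) <= INR N.+1 * E.
  apply: IH => // i; have -> : z i - y i = (1 - t) * (x i - y i) by rewrite /z; ring.
  rewrite Rabs_mult Rabs_pos_eq; last by lra.
  have -> : 1 - t = INR N.+1 * t by lra.
  rewrite Rmult_assoc; apply: Rmult_le_compat_l; first by lra.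
  have := Rmult_le_compat_l t _ _ (Rlt_le _ _ t0) (xy i).
  by rewrite (S_INR N.+1) -Rmult_assoc tN Rmult_1_l.
have := Rabs_triang (f x - f z) (f z - f y).
have -> : f x - f z + (f z - f y) = f x - f y by ring.
by rewrite (S_INR N.+1); lra.
Qed.

Lemma modulus_le_scale (d : nat) (a b : 'I_d -> R) (f : ('I_d -> R) -> R) (delta E c : R) :
  0 < delta -> 0 <= E -> 0 <= c ->
  modulus_le a b f delta E -> modulus_le a b f (c * delta) ((1 + c) * E).
Proof.
move=> d0 E0 c0 H x y Ix Iy xy.
have [N [Nc cN]] := nfloor_ex c c0.
apply: (Rle_trans _ (INR N.+1 * E)); last by rewrite S_INR; apply: Rmult_le_compat_r; lra.
apply: (modulus_le_chain _ _ _ _ _ _ N H) => // i; apply: Rle_trans (xy i) _.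
by rewrite S_INR; apply: Rmult_le_compat_r; lra.
Qed.

(** Uniform continuity gives some scale at which the oscillation is at most 1; scaling reaches any
    other delta. *)
Lemma modulus_le_ex (d : nat) (a b : 'I_d -> R) (f : ('I_d -> R) -> R) (delta : R) :
  (forall i, a i <= b i) -> cont_on_I a b f -> 0 < delta ->
  exists2 E, 0 <= E & modulus_le a b f delta E.
Proof.
move=> Hab Hf d0; have [e e0 H] := unif_cont_on_I _ _ _ _ Hab Hf 1 Rlt_0_1.
have c0 : 0 <= delta / e by apply: Rlt_le; apply: Rdiv_lt_0_compat.
exists ((1 + delta / e) * 1); first by lra.
have -> : delta = delta / e * e by field; lra.
have -> : delta / e * e / e = delta / e by field; lra.
by apply: modulus_le_scale => //; lra.
Qed.

(** * Iterated integrals over small boxes *)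

(** Uniform continuity passes through integration in one coordinate, so every layer of the iterated
    integral is integrable. *)
Definition unif_cont {d : nat} (g : ('I_d -> R) -> R) : Prop :=
  forall eps, 0 < eps -> exists2 delta, 0 < delta &
    forall x y, (forall i, Rabs (x i - y i) <= delta) -> Rabs (g x - g y) <= eps.

Definition box_int_on {d : nat} (lo hi : 'I_d -> R) (g : ('I_d -> R) -> R) (s : seq 'I_d) :
    ('I_d -> R) -> R :=
  foldr (fun i (G : ('I_d -> R) -> R) =>
            fun x => RInt (fun t => G (upd x i t)) (lo i) (hi i)) g s.

Lemma Rabs_RInt_minus_le (f g : R -> R) (l h c : R) :
  l <= h -> ex_RInt f l h -> ex_RInt g l h ->
  (forall t, l <= t <= h -> Rabs (f t - g t) <= c) ->
  Rabs (RInt f l h - RInt g l h) <= (h - l) * c.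
Proof.
move=> lh If Ig fg.
have -> : RInt f l h - RInt g l h = RInt (fun t => f t - g t) l h.
  by symmetry; exact: (RInt_minus (V := R_CompleteNormedModule) f g).
by apply: abs_RInt_le_const => //; exact: (ex_RInt_minus (V := R_CompleteNormedModule) f g).
Qed.

Lemma unif_cont_ex_RInt (d : nat) (g : ('I_d -> R) -> R) (x : 'I_d -> R) (i : 'I_d) (l h : R) :
  unif_cont g -> ex_RInt (fun t => g (upd x i t)) l h.
Proof.
move=> Hg; apply: (ex_RInt_continuous (V := R_CompleteNormedModule)) => t _.
apply/filterlim_locally => eps.
have [dl dl0 H] := Hg (eps / 2) ltac:(have := cond_pos eps; lra).
exists (mkposreal _ dl0) => s st.
apply: (Rle_lt_trans _ (eps / 2)); last by have := cond_pos eps; lra.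
apply: H => j; rewrite /upd; case: (j == i); first by apply: Rlt_le.
by rewrite Rminus_eq_0 Rabs_R0; lra.
Qed.

Lemma unif_cont_box_int_on (d : nat) (lo hi : 'I_d -> R) (g : ('I_d -> R) -> R) (s : seq 'I_d) :
  (forall i, lo i <= hi i) -> unif_cont g -> unif_cont (box_int_on lo hi g s).
Proof.
move=> lohi Hg; elim: s => [//|i s IH] eps eps0 /=.
have lh := lohi i.
(* The added 1 keeps the divisor positive when the side is degenerate. *)
have [|dl dl0 H] := IH (eps / (hi i - lo i + 1)); first by apply: Rdiv_lt_0_compat; lra.
exists dl => // x y xy.
apply: (Rle_trans _ ((hi i - lo i) * (eps / (hi i - lo i + 1)))).
  apply: Rabs_RInt_minus_le => //; try exact: unif_cont_ex_RInt.
  move=> t _; apply: H => j; rewrite /upd; case: (j == i) => //.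
  by rewrite Rminus_eq_0 Rabs_R0; lra.
have -> : (hi i - lo i) * (eps / (hi i - lo i + 1)) = eps - eps / (hi i - lo i + 1).
  by field; lra.
have : 0 < eps / (hi i - lo i + 1) by apply: Rdiv_lt_0_compat; lra.
lra.
Qed.

Lemma box_int_on_near (d : nat) (lo : 'I_d -> R) (h : R) (g : ('I_d -> R) -> R) (v e : R)
    (s : seq 'I_d) (x : 'I_d -> R) :
  0 <= h -> unif_cont g -> (forall y, Rabs (g y - v) <= e) ->
  Rabs (box_int_on lo (fun i => lo i + h) g s x - v * h ^ size s) <= e * h ^ size s.
Proof.
move=> h0 Hg Hv; elim: s x => [|i s IH] x /=; first by rewrite !Rmult_1_r.
have c : RInt (fun _ => v * h ^ size s) (lo i) (lo i + h) = v * (h * h ^ size s).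
  by rewrite (RInt_const (V := R_CompleteNormedModule)) /scal /= /mult /=; ring.
have UG := unif_cont_box_int_on _ lo (fun i => lo i + h) g s ltac:(move=> j; lra) Hg.
have Ic := ex_RInt_const (V := R_NormedModule) (lo i) (lo i + h) (v * h ^ size s).
rewrite -c.
have -> : e * (h * h ^ size s) = (lo i + h - lo i) * (e * h ^ size s) by ring.
by apply: Rabs_RInt_minus_le => [|||t _]; [lra | exact: unif_cont_ex_RInt | exact: Ic | exact: IH].
Qed.

Lemma box_int_on_ext (d : nat) (lo hi : 'I_d -> R) (f g : ('I_d -> R) -> R) (s : seq 'I_d)
    (x : 'I_d -> R) :
  (forall i, lo i <= hi i) -> (forall y, inI lo hi y -> f y = g y) ->
  (forall j, j \notin s -> lo j <= x j <= hi j) ->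
  box_int_on lo hi f s x = box_int_on lo hi g s x.
Proof.
move=> lohi fg; elim: s x => [|i s IH] x Hx /=; first by apply: fg => j; exact: Hx.
apply: RInt_ext => t; rewrite Rmin_left // Rmax_right // => tb.
apply: IH => j js; rewrite /upd; case: eqP => [->|/eqP ji]; first by lra.
by apply: Hx; rewrite inE negb_or ji.
Qed.

Definition clamp (l h t : R) : R := Rmax l (Rmin t h).

Lemma clamp_bounds (l h t : R) : l <= h -> l <= clamp l h t <= h.
Proof.
by move=> lh; rewrite /clamp /Rmin; case: Rle_dec => ?; rewrite /Rmax; case: Rle_dec => ?; lra.
Qed.

Lemma clamp_id (l h t : R) : l <= t <= h -> clamp l h t = t.
Proof. by move=> H; rewrite /clamp Rmin_left ?Rmax_right; lra. Qed.

Lemma clamp_lipschitz (l h s t : R) : l <= h -> Rabs (clamp l h s - clamp l h t) <= Rabs (s - t).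
Proof.
move=> lh; rewrite /clamp /Rmin; repeat (case: Rle_dec => ?); rewrite /Rmax;
  repeat (case: Rle_dec => ?); rewrite /Rabs; repeat (case: Rcase_abs => ?); lra.
Qed.

(* The integrand is continuous on I only; precomposing it with the projection onto the
   small box makes it uniformly continuous everywhere without changing the integral. *)
Lemma box_int_near (d : nat) (a b lo : 'I_d -> R) (h : R) (f : ('I_d -> R) -> R) (v e : R) :
  (forall i, a i <= b i) -> cont_on_I a b f -> 0 <= h ->
  (forall i, a i <= lo i) -> (forall i, lo i + h <= b i) ->
  (forall y, inI lo (fun i => lo i + h) y -> Rabs (f y - v) <= e) ->
  Rabs (box_int lo (fun i => lo i + h) f - v * h ^ d) <= e * h ^ d.
Proof.
move=> Hab Hf h0 alo hib Hv.
pose pr (y : 'I_d -> R) i := clamp (lo i) (lo i + h) (y i).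
have prI y : inI lo (fun i => lo i + h) (pr y) by move=> i; apply: clamp_bounds; lra.
have subI y : inI lo (fun i => lo i + h) y -> inI a b y.
  by move=> H i; have := H i; have := alo i; have := hib i; lra.
have U : unif_cont (fun y => f (pr y)).
  move=> eps eps0; have [dl dl0 H] := unif_cont_on_I _ _ _ _ Hab Hf eps eps0.
  exists dl => // x y xy; apply: H => [||i]; try exact: subI (prI _).
  by apply: Rle_trans (xy i); apply: clamp_lipschitz; lra.
have := box_int_on_near d lo h _ v e (enum 'I_d) (fun _ => 0) h0 U (fun y => Hv _ (prI y)).
rewrite size_enum_ord -(box_int_on_ext d lo (fun i => lo i + h) f) //.
- by move=> i; lra.
- move=> y Iy; congr f; apply: functional_extensionality => i.
  by rewrite /pr clamp_id //; exact: Iy.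
by move=> j; rewrite mem_enum.
Qed.

(** * Bernstein inequality for the operators *)

(** A point of the cell differs from x in coordinate i by at most (1 + |n x_i - k_i|) / n, and
    scaling the modulus up from 1/n costs one more unit: hence the 2. The index bounds keep the cell
    inside I. *)
Lemma Kantorovich_mean_near (d : nat) (a b : 'I_d -> R) (f : ('I_d -> R) -> R) (n : nat)
    (E : R) (k : 'I_d -> Z) (x : 'I_d -> R) :
  (forall i, a i <= b i) -> cont_on_I a b f -> 0 < INR n -> 0 <= E ->
  modulus_le a b f (/ INR n) E ->
  (forall i, (Zceil (INR n * a i) <= k i <= Zfloor (INR n * b i) - 1)%Z) -> inI a b x ->
  Rabs (INR n ^ d * box_int (fun i => IZR (k i) / INR n) (fun i => (IZR (k i) + 1) / INR n) f
        - f x)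
  <= E * (2 + \big[Rplus/0]_(m < d) Rabs (INR n * x m - IZR (k m))).
Proof.
move=> Hab Hf n0 E0 HE Hk Ix; set sg := \big[Rplus/0]_(m < d) _.
have h0 : 0 < / INR n by exact: Rinv_0_lt_compat.
have sg0 : 0 <= sg by apply: sum_ge0 => m; exact: Rabs_pos.
have lo i : a i <= IZR (k i) / INR n.
  apply/Rle_div_r => //; have := Zceil_spec (INR n * a i).
  by have := IZR_le _ _ (proj1 (Hk i)); lra.
have hi i : IZR (k i) / INR n + / INR n <= b i.
  have -> : IZR (k i) / INR n + / INR n = (IZR (k i) + 1) / INR n by field; lra.
  apply/Rle_div_l => //; have := Zfloor_spec (INR n * b i).
  by have := IZR_le _ _ (proj2 (Hk i)); rewrite minus_IZR; lra.
have -> : (fun i => (IZR (k i) + 1) / INR n) = (fun i => IZR (k i) / INR n + / INR n).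
  by apply: functional_extensionality => i; field; lra.
have Hy y : inI (fun i => IZR (k i) / INR n) (fun i => IZR (k i) / INR n + / INR n) y ->
    Rabs (f y - f x) <= (1 + (1 + sg)) * E.
  move=> Iy; apply: (modulus_le_scale _ _ _ _ _ _ _ h0 E0 _ HE) => //; first by lra.
    by move=> i; have := Iy i; have := lo i; have := hi i; lra.
  move=> i; have yi := Iy i.
  have le_sg : Rabs (INR n * x i - IZR (k i)) <= sg.
    apply: (sum_ord_ge_term d (fun m => Rabs (INR n * x m - IZR (k m)))) => j; exact: Rabs_pos.
  apply: (Rmult_le_reg_l (INR n)) => //.
  have -> : INR n * ((1 + sg) * / INR n) = 1 + sg by field; lra.
  rewrite -{1}(Rabs_pos_eq (INR n)); last by lra.
  rewrite -Rabs_mult.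
  have -> : INR n * (y i - x i) = INR n * (y i - IZR (k i) / INR n) + - (INR n * x i - IZR (k i)).
    by field; lra.
  apply: Rle_trans (Rabs_triang _ _) _; rewrite Rabs_Ropp; apply: Rplus_le_compat => //.
  rewrite Rabs_pos_eq; last by apply: Rmult_le_pos; lra.
  have -> : 1 = INR n * / INR n by field; lra.
  by apply: Rmult_le_compat_l; lra.
have H := box_int_near d a b _ _ f _ _ Hab Hf (Rlt_le _ _ h0) lo hi Hy.
set J := box_int _ _ _ in H *.
have nd0 : 0 < INR n ^ d by exact: pow_lt.
have -> : INR n ^ d * J - f x = INR n ^ d * (J - f x * (/ INR n) ^ d).
  by rewrite pow_inv; field; lra.
rewrite Rabs_mult Rabs_pos_eq; last by lra.
apply: Rle_trans (Rmult_le_compat_l _ _ _ (Rlt_le _ _ nd0) H) _; apply: Req_le.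
by rewrite pow_inv; field; lra.
Qed.

(* Replacing every c k by c k - v does not change the derivative of the quotient. *)
Lemma quotient_derivative_le (T : Type) (P : T -> Prop) (s : seq T) (c lam w dw : T -> R)
    (v E D B m : R) :
  List.Forall P s -> 0 <= E -> 0 < m ->
  (forall k, P k -> Rabs (c k - v) <= E * lam k) -> (forall k, 1 <= lam k) ->
  \big[Rplus/0]_(k <- s) (lam k * Rabs (w k)) <= B ->
  \big[Rplus/0]_(k <- s) (lam k * Rabs (dw k)) <= D ->
  m <= \big[Rplus/0]_(k <- s) w k ->
  Rabs ((\big[Rplus/0]_(k <- s) (c k * dw k) * (\big[Rplus/0]_(k <- s) w k)
         - \big[Rplus/0]_(k <- s) (c k * w k) * (\big[Rplus/0]_(k <- s) dw k))
        / (\big[Rplus/0]_(k <- s) w k) ^ 2)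
  <= E * D * (/ m + B * (/ m) ^ 2).
Proof.
move=> Ps E0 m0 Hc lam1 HB HD; set S := \big[Rplus/0]_(k <- s) w k => mS.
set S' := \big[Rplus/0]_(k <- s) dw k.
have shift g : \big[Rplus/0]_(k <- s) (c k * g k)
    = \big[Rplus/0]_(k <- s) ((c k - v) * g k) + v * \big[Rplus/0]_(k <- s) g k.
  by rewrite -sum_distrl -big_split; apply: eq_bigr => k _ /=; ring.
rewrite !shift -/S -/S'.
set A' := \big[Rplus/0]_(k <- s) (_ * dw k); set A := \big[Rplus/0]_(k <- s) (_ * w k).
have bound g G : \big[Rplus/0]_(k <- s) (lam k * Rabs (g k)) <= G ->
    Rabs (\big[Rplus/0]_(k <- s) ((c k - v) * g k)) <= E * G.
  move=> HG; apply: Rle_trans (Rabs_sum_le _ _ _) _.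
  apply: (Rle_trans _ (E * \big[Rplus/0]_(k <- s) (lam k * Rabs (g k)))); last first.
    exact: Rmult_le_compat_l.
  rewrite -sum_distrl; apply: (sum_le _ P) => // k /Hc ck.
  rewrite Rabs_mult -Rmult_assoc; apply: Rmult_le_compat_r => //; exact: Rabs_pos.
have A'b : Rabs A' <= E * D by exact: bound.
have Ab : Rabs A <= E * B by exact: bound.
have S'b : Rabs S' <= D.
  apply: Rle_trans (Rabs_sum_le _ _ _) _; apply: Rle_trans HD.
  by apply: sum_le_all => k; have := Rabs_pos (dw k); have := lam1 k; nra.
have Spos : 0 < S by lra.
have -> : ((A' + v * S') * S - (A + v * S) * S') / S ^ 2 = A' * / S + - (A * S' * (/ S) ^ 2).
  by field; lra.
have i0 : 0 < / S by exact: Rinv_0_lt_compat.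
have im : / S <= / m by apply: Rinv_le_contravar.
apply: Rle_trans (Rabs_triang _ _) _; rewrite Rabs_Ropp (Rabs_mult A') (Rabs_mult (A * S')) (Rabs_mult A).
rewrite (Rabs_pos_eq (/ S)); last by lra.
rewrite (Rabs_pos_eq ((/ S) ^ 2)); last by exact: pow2_ge_0.
rewrite Rmult_plus_distr_l; apply: Rplus_le_compat.
  by apply: Rmult_le_compat => //; [exact: Rabs_pos | lra].
have -> : E * D * (B * (/ m) ^ 2) = E * B * D * (/ m) ^ 2 by ring.
apply: Rmult_le_compat; [|exact: pow2_ge_0| |by apply: pow_incr; lra].
  by apply: Rmult_le_pos; exact: Rabs_pos.
by apply: Rmult_le_compat => //; exact: Rabs_pos.
Qed.

(** The absolute value of the derivative is written as a product over coordinates, the shape that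
    [moment_sum_le] sums. *)
Lemma is_derive_Psi_sigma_upd (d : nat) (sigma : R -> R) (n : nat) (k : 'I_d -> Z)
    (x : 'I_d -> R) (i : 'I_d) (t : R) :
  (forall x : R, ex_derive sigma x) -> (forall v, 0 <= phi_sigma sigma v) ->
  exists2 dw,
    is_derive (fun t => Psi_sigma sigma (fun j => INR n * upd x i t j - IZR (k j))) t dw &
    Rabs dw = INR n * \big[Rmult/1]_(j < d)
      (if j == i then Rabs (Derive (phi_sigma sigma) (INR n * upd x i t j - IZR (k j)))
       else phi_sigma sigma (INR n * upd x i t j - IZR (k j))).
Proof.
move=> HC1 phi0; have [Dphi _] := Derive_phi_sigma sigma HC1 (INR n * t - IZR (k i)).
set p := \big[Rmult/1]_(j < d | j != i) phi_sigma sigma (INR n * x j - IZR (k j)).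
exists (INR n * Derive (phi_sigma sigma) (INR n * t - IZR (k i)) * p).
  apply: (is_derive_ext (fun t => phi_sigma sigma (INR n * t - IZR (k i)) * p)).
    move=> r; rewrite /Psi_sigma (bigD1 i) //= upd_eq; congr (_ * _).
    by apply: eq_bigr => j ji; rewrite upd_neq.
  apply: is_derive_scal_l.
  apply: (is_derive_comp (phi_sigma sigma) (fun r => INR n * r - IZR (k i))) => //.
  by auto_derive => //; ring.
rewrite (bigD1 i) //= eqxx upd_eq.
rewrite [X in _ = _ * (_ * X)](_ : _ = p); last first.
  by apply: eq_bigr => j ji; rewrite (negbTE ji) upd_neq.
have p0 : 0 <= p.
  by rewrite /p -big_filter; exact: prod_ge0.
by rewrite !Rabs_mult (Rabs_pos_eq p) // (Rabs_pos_eq (INR n)); [ring | exact: pos_INR].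
Qed.

(* B is a common bound for the integer-translate sums of the kernels and m a lower bound for
   phi_sigma on [-2, 2]. *)
Definition Bernstein_const (d : nat) (B m : R) : R :=
  (2 + INR d) * B ^ d * (/ (m ^ d) + (2 + INR d) * B ^ d * (/ (m ^ d)) ^ 2).

Lemma K_n_upd_lipschitz (sigma : R -> R) (d : nat) (a b : 'I_d -> R)
    (f : ('I_d -> R) -> R) (B m : R) (n : nat) (E : R) (x : 'I_d -> R) (i : 'I_d) (s t : R) :
  (forall x : R, ex_derive sigma x) -> (forall v, 0 <= phi_sigma sigma v) ->
  1 <= B ->
  (forall u l h, \big[Rplus/0]_(k <- Zrange l h) phi_sigma sigma (u - IZR k) <= B) ->
  (forall u l h,
    \big[Rplus/0]_(k <- Zrange l h) (phi_sigma sigma (u - IZR k) * Rabs (u - IZR k)) <= B) ->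
  (forall u l h,
    \big[Rplus/0]_(k <- Zrange l h) Rabs (Derive (phi_sigma sigma) (u - IZR k)) <= B) ->
  (forall u l h,
    \big[Rplus/0]_(k <- Zrange l h)
       (Rabs (Derive (phi_sigma sigma) (u - IZR k)) * Rabs (u - IZR k)) <= B) ->
  0 < m -> (forall v, Rabs v <= 2 -> m <= phi_sigma sigma v) ->
  (forall j, a j <= b j) -> cont_on_I a b f ->
  0 < INR n -> (forall j, 3 <= INR n * b j - INR n * a j) -> 0 <= E ->
  modulus_le a b f (/ INR n) E ->
  inI a b x -> a i <= s <= b i -> a i <= t <= b i ->
  Rabs (K_n sigma a b f n (upd x i t) - K_n sigma a b f n (upd x i s))
  <= INR n * E * Bernstein_const d B m * Rabs (t - s).
Proof.
move=> HC1 phi0 B1 B1phi B2phi B1d B2d m0 mphi Hab Hf n0 n3 E0 HE Ix Is It.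
set ks := box_idx (fun j => Zceil (INR n * a j)) (fun j => (Zfloor (INR n * b j) - 1)%Z).
pose c (k : 'I_d -> Z) := INR n ^ d *
  box_int (fun i => IZR (k i) / INR n) (fun i => (IZR (k i) + 1) / INR n) f.
pose w (k : 'I_d -> Z) r := Psi_sigma sigma (fun j => INR n * upd x i r j - IZR (k j)).
pose dw k r := proj1_sig (constructive_indefinite_description _
   (let: ex_intro2 e e1 e2 := is_derive_Psi_sigma_upd d sigma n k x i r HC1 phi0 in
    ex_intro (fun e => _ /\ _) e (conj e1 e2))).
have Hdw k r : is_derive (w k) r (dw k r) /\ Rabs (dw k r) = INR n * \big[Rmult/1]_(j < d)
      (if j == i then Rabs (Derive (phi_sigma sigma) (INR n * upd x i r j - IZR (k j)))
       else phi_sigma sigma (INR n * upd x i r j - IZR (k j))).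
  by rewrite /dw; case: constructive_indefinite_description.
pose S r := \big[Rplus/0]_(k <- ks) w k r.
pose N r := \big[Rplus/0]_(k <- ks) (c k * w k r).
have KE r : K_n sigma a b f n (upd x i r) = N r / S r by [].
have Ir r : a i <= r <= b i -> inI a b (upd x i r).
  by move=> rab j; rewrite /upd; case: eqP => [->|].
have mS r : a i <= r <= b i -> m ^ d <= S r.
  move=> rab; apply: (sum_Psi_ge d sigma m (fun j => INR n * a j) (fun j => INR n * b j)) => //.
    by lra.
  by move=> j; have := Ir r rab j; split; apply: Rmult_le_compat_l; lra.
have md0 : 0 < m ^ d by exact: pow_lt.
pose dK r := ((\big[Rplus/0]_(k <- ks) (c k * dw k r)) * S r
   - N r * (\big[Rplus/0]_(k <- ks) dw k r)) / S r ^ 2.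
have DK r : a i <= r <= b i -> is_derive (fun r => N r / S r) r (dK r).
  move=> rab; apply: is_derive_div; last by have := mS r rab; lra.
    apply: (is_derive_sum _ ks (fun k r => c k * w k r) (fun k r => c k * dw k r)) => k.
    by apply: is_derive_scal; case: (Hdw k r).
  by apply: (is_derive_sum _ ks w dw) => k; case: (Hdw k r).
have dKb r : a i <= r <= b i -> Rabs (dK r) <= INR n * E * Bernstein_const d B m.
  move=> rab.
  have lam1 (k : 'I_d -> Z) : 1 <= 2 + \big[Rplus/0]_(j < d) Rabs (INR n * upd x i r j - IZR (k j)).
    suff : 0 <= \big[Rplus/0]_(j < d) Rabs (INR n * upd x i r j - IZR (k j)) by lra.
    by apply: sum_ge0 => j; exact: Rabs_pos.
  (* The value subtracted from the means is f at the current point, and the weight is the one from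
     [Kantorovich_mean_near]. The extra factor n in the bound for dw is the chain rule. *)
  have := quotient_derivative_le _ _ ks c
    (fun k => 2 + \big[Rplus/0]_(j < d) Rabs (INR n * upd x i r j - IZR (k j)))
    (fun k => w k r) (fun k => dw k r) (f (upd x i r)) E (INR n * ((2 + INR d) * B ^ d))
    ((2 + INR d) * B ^ d) (m ^ d) (Forall_box_idx _ _ _) E0 md0 _ lam1 _ _ (mS r rab).
  rewrite /Bernstein_const => H; apply: Rle_trans (H _ _ _) _; last by apply: Req_le; ring.
  - by move=> k Hk; apply: Kantorovich_mean_near => //; exact: Ir.
  - apply: Rle_trans (moment_sum_le d (fun _ => phi_sigma sigma) B (fun j => INR n * upd x i r j)
      _ _ B1 _ _ _) => //.
    apply: sum_le_all => k; rewrite Rabs_pos_eq; first exact: Rle_refl.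
    exact: prod_ge0.
  - have := moment_sum_le d (fun j v => if j == i then Rabs (Derive (phi_sigma sigma) v)
       else phi_sigma sigma v) B (fun j => INR n * upd x i r j)
       (fun j => Zceil (INR n * a j)) (fun j => (Zfloor (INR n * b j) - 1)%Z) B1.
    move=> M; apply: Rle_trans (Rmult_le_compat_l _ _ _ (Rlt_le _ _ n0) (M _ _ _)).
    + rewrite -sum_distrl; apply: sum_le_all => k; rewrite (proj2 (Hdw k r)).
      by apply: Req_le; ring.
    + by move=> j v; case: (j == i) => //; exact: Rabs_pos.
    + by move=> j v l h; case: (j == i).
    + by move=> j v l h; case: (j == i).
have between r : Rmin s t <= r <= Rmax s t -> a i <= r <= b i.
  by rewrite /Rmin /Rmax; case: Rle_dec => ? /=; lra.
rewrite !KE.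
have [||r [rb ->]] := MVT_gen (fun r => N r / S r) s t dK.
- by move=> r rb; apply: DK; apply: between; lra.
- move=> r rb; apply/continuity_pt_filterlim.
  exact: (ex_derive_continuous (fun r => N r / S r) r (ex_intro _ _ (DK r (between r rb)))).
rewrite Rabs_mult; apply: Rmult_le_compat_r; first exact: Rabs_pos.
by apply: dKb; exact: between.
Qed.

(** * Inverse estimate *)

(** Coordinates of x are replaced by those of y one at a time. The intermediate points stay in I
    because I is a product, and each replacement moves K by at most L t. *)
Lemma modulus_le_approx (d : nat) (a b : 'I_d -> R) (f K : ('I_d -> R) -> R) (e L t : R) :
  0 <= L ->
  (forall x, inI a b x -> Rabs (K x - f x) <= e) ->
  (forall x i r s, inI a b x -> a i <= r <= b i -> a i <= s <= b i ->
     Rabs (K (upd x i s) - K (upd x i r)) <= L * Rabs (s - r)) ->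
  modulus_le a b f t (2 * e + INR d * (L * t)).
Proof.
move=> L0 Ke KL x y Ix Iy xy.
pose z (s : seq 'I_d) i := if i \in s then y i else x i.
have Iz s : inI a b (z s) by move=> i; rewrite /z; case: (i \in s).
have Hz s : Rabs (K (z s) - K x) <= INR (size s) * (L * t).
  elim: s => [|i s IH]; first by rewrite Rminus_eq_0 Rabs_R0 /=; lra.
  have zE : z (i :: s) = upd (z s) i (y i).
    by apply: functional_extensionality => j; rewrite /z /upd inE; case: eqP => [->|].
  have step : Rabs (K (z (i :: s)) - K (z s)) <= L * t.
    have := KL (z s) i (z s i) (y i) (Iz s) (Iz s i) (Iy i).
    rewrite upd_id -zE => H; apply: Rle_trans H _.
    apply: Rmult_le_compat_l => //; rewrite Rabs_minus_sym /z; case: (i \in s); last exact: xy.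
    rewrite Rminus_eq_0 Rabs_R0; have := xy i; have := Rabs_pos (x i - y i); lra.
  have := Rabs_triang (K (z (i :: s)) - K (z s)) (K (z s) - K x).
  have -> : K (z (i :: s)) - K (z s) + (K (z s) - K x) = K (z (i :: s)) - K x by ring.
  by rewrite [size _]/= S_INR; lra.
have zy : z (enum 'I_d) = y by apply: functional_extensionality => i; rewrite /z mem_enum.
have := Hz (enum 'I_d); rewrite zy size_enum_ord => Kyx.
have := Ke x Ix; have := Ke y Iy; rewrite (Rabs_minus_sym (K x)) => ey ex.
have := Rabs_triang (f x - K x) (K x - f y); have := Rabs_triang (K x - K y) (K y - f y).
rewrite (Rabs_minus_sym (K x) (K y)).
have -> : f x - K x + (K x - f y) = f x - f y by ring.
have -> : K x - K y + (K y - f y) = K x - f y by ring.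
lra.
Qed.

(** Equivalent to c <= A^(1 - nu), which holds for large A as nu < 1. The bound A >= 2 makes the
    powers of A grow. *)
Lemma INR_Rpower_ge (c nu : R) : nu < 1 ->
  exists2 A : nat, (2 <= A)%nat & c * Rpower (INR A) nu <= INR A.
Proof.
move=> nu1; pose y := Rpower (Rabs c + 1) (/ (1 - nu)).
have y0 : 0 < y by exact: exp_pos.
have [A [_ yA]] := nfloor_ex y (Rlt_le _ _ y0).
exists A.+2 => //.
have A0 : 0 < INR A.+2 by apply: lt_0_INR; apply/ltP.
have yA2 : y <= INR A.+2 by rewrite !S_INR; lra.
have cA : c <= Rpower (INR A.+2) (1 - nu).
  have := Rle_Rpower_l y (INR A.+2) (1 - nu) ltac:(lra) (conj y0 yA2).
  rewrite /y Rpower_mult Rinv_l ?Rpower_1; try by have := Rabs_pos c; lra.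
  by have := Rle_abs c; lra.
have {2}-> : INR A.+2 = Rpower (INR A.+2) (1 - nu) * Rpower (INR A.+2) nu.
  by rewrite -Rpower_plus -[LHS]Rpower_1 //; congr Rpower; ring.
by apply: Rmult_le_compat_r => //; apply: Rlt_le; exact: exp_pos.
Qed.

(* Berens-Lorentz argument along the geometric sequence n_j = n0 A^j: with A so large that
   C1 A^nu <= A / 2, the term C1 t n E of the inequality is absorbed. *)
Lemma Berens_Lorentz (W : R -> R -> Prop) (nu C0 C1 E0 : R) (n0 : nat) :
  0 < nu < 1 -> 0 <= C0 -> 0 <= E0 -> (0 < n0)%nat ->
  (forall t E E', E <= E' -> W t E -> W t E') ->
  (forall t t' E, t <= t' -> W t' E -> W t E) ->
  W (/ INR n0) E0 ->
  (forall n E t, (n0 <= n)%nat -> 0 <= E -> W (/ INR n) E ->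
     W t (C0 * Rpower (INR n) (- nu) + C1 * (t * INR n * E))) ->
  exists C, forall t, 0 < t <= / INR n0 -> W t (C * Rpower t nu).
Proof.
move=> Hnu C00 E00 n00 WE Wt W0 Wstep.
have [A A2 HA] := INR_Rpower_ge (2 * C1) nu (proj2 Hnu).
have INRpos n : (0 < n)%nat -> 0 < INR n by move=> /ltP; exact: lt_0_INR.
have A0 : 0 < INR A by apply: INRpos; exact: ltn_trans A2.
pose n j := (n0 * A ^ j)%nat.
have nS j : INR (n j.+1) = INR A * INR (n j).
  by rewrite /n expnS mulnCA -multE mult_INR.
have n_gt0 j : (0 < n j)%nat by rewrite muln_gt0 n00 expn_gt0 (ltn_trans _ A2).
have nj0 j : 0 < INR (n j) by exact: INRpos.
have n0n j : (n0 <= n j)%nat by rewrite leq_pmulr // expn_gt0 (ltn_trans _ A2).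
pose p := Rpower (INR A) nu; have p0 : 0 < p by exact: exp_pos.
pose r j := Rpower (INR (n j)) (- nu); have r0 j : 0 < r j by exact: exp_pos.
have rS j : r j = p * r j.+1.
  rewrite /r nS -Rpower_mult_distr // /p -Rmult_assoc -Rpower_plus.
  have -> : nu + - nu = 0 by ring.
  by rewrite Rpower_O // Rmult_1_l.
(* The first summand starts the induction; the second gives C0 r_j <= K r_(j+1) / 2, the other half
   of K r_(j+1) being reserved for the C1 term. *)
pose K := E0 / r 0%N + 2 * C0 * p.
have K1 : 0 <= E0 / r 0%N by apply: Rdiv_le_0_compat.
have K2 : 0 <= 2 * C0 * p by apply: Rmult_le_pos; lra.
have K0 : 0 <= K by rewrite /K; lra.
have Wn j : W (/ INR (n j)) (K * r j).
  elim: j => [|j IH].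
    have -> : n 0%N = n0 by rewrite /n muln1.
    apply: WE W0; rewrite /K Rmult_plus_distr_r.
    have -> : E0 / r 0%N * r 0%N = E0 by field; apply: Rgt_not_eq.
    by have := Rmult_le_pos _ _ K2 (Rlt_le _ _ (r0 0%N)); lra.
  have Kr : 0 <= K * r j by apply: Rmult_le_pos => //; apply: Rlt_le.
  apply: WE (Wstep (n j) _ (/ INR (n j.+1)) (n0n j) Kr IH).
  have -> : / INR (n j.+1) * INR (n j) * (K * r j) = K * r j / INR A.
    by rewrite nS; field; split; apply: Rgt_not_eq => //; exact: nj0.
  have H1 : C1 * (K * r j / INR A) <= K * r j.+1 / 2.
    have -> : C1 * (K * r j / INR A) = (K * r j.+1 / 2) * (2 * C1 * p / INR A).
      by rewrite rS; field; apply: Rgt_not_eq.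
    rewrite -[X in _ <= X]Rmult_1_r; apply: Rmult_le_compat_l.
      by have := Rmult_le_pos _ _ K0 (Rlt_le _ _ (r0 j.+1)); lra.
    by apply/Rle_div_l => //; rewrite Rmult_1_l.
  have H2 : C0 * r j <= K * r j.+1 / 2.
    have : 2 * C0 * p * r j.+1 <= K * r j.+1.
      by apply: Rmult_le_compat_r; [apply: Rlt_le | rewrite /K; lra].
    by rewrite (rS j); lra.
  by rewrite -/(r j); lra.
exists (K * p) => t [t0 tn0].
have large : exists j, / INR (n j) < t.
  have [j [_ tj]] := nfloor_ex (/ t) (Rlt_le _ _ (Rinv_0_lt_compat _ t0)).
  exists j.+1; rewrite -(Rinv_inv t); apply: Rinv_lt_contravar.
    by apply: Rmult_lt_0_compat => //; exact: Rinv_0_lt_compat.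
  apply: (Rlt_le_trans _ (INR j.+1)); first by rewrite S_INR.
  apply: le_INR; apply/leP; apply: leq_trans (ltnW (ltn_expl j.+1 A2)) _.
  by rewrite leq_pmull.
have [j [tj1 tj]] : exists j, / INR (n j.+1) < t /\ t <= / INR (n j).
  case: large; elim=> [|j IH] tj.
    by move: tj; rewrite /n muln1; lra.
  case: (Rlt_le_dec (/ INR (n j)) t) => [/IH //|jt].
  by exists j.
(* Passing from t to the grid costs a factor p: r_j = p r_(j+1), and r_(j+1) = (1 / n_(j+1))^nu <=
   t^nu. *)
apply: Wt tj _; apply: WE (Wn j).
rewrite rS Rmult_assoc; apply: Rmult_le_compat_l => //; apply: Rmult_le_compat_l; first by lra.
have -> : r j.+1 = Rpower (/ INR (n j.+1)) nu.
  have -> : / INR (n j.+1) = Rpower (INR (n j.+1)) (- (1)) by rewrite Rpower_Ropp Rpower_1.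
  by rewrite Rpower_mult /r; congr Rpower; ring.
apply: Rle_Rpower_l; first by lra.
by split; [exact: Rinv_0_lt_compat | lra].
Qed.

(** The sum of all 3 / (b_i - a_i) serves as an upper bound for their maximum. *)
Lemma box_side_lower_bound (d : nat) (a b : 'I_d -> R) : (forall i, a i < b i) ->
  exists N : nat, forall n, (N <= n)%nat -> forall i, 3 <= INR n * b i - INR n * a i.
Proof.
move=> Hab; pose g i := 3 / (b i - a i).
have g0 i : 0 <= g i by apply: Rdiv_le_0_compat; have := Hab i; lra.
have [N [_ HN]] := nfloor_ex (\big[Rplus/0]_(i < d) g i) (sum_ge0 _ _ _ g0).
exists N.+1 => n /leP /le_INR; rewrite S_INR => Nn i.
have := sum_ord_ge_term d g i g0; have ab := Hab i.
have -> : 3 = g i * (b i - a i) by rewrite /g; field; lra.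
have -> : INR n * b i - INR n * a i = INR n * (b i - a i) by ring.
by move=> gi; apply: Rmult_le_compat_r; lra.
Qed.

Theorem theorem3p2 (sigma : R -> R) (alpha : R) (d : nat) (a b : 'I_d -> R)
    (f : ('I_d -> R) -> R) (nu : R)
    (* sigmoidal, non-decreasing *)
    (Hmono : forall x y, x <= y -> sigma x <= sigma y)
    (Hlim_m : is_lim sigma m_infty 0)
    (Hlim_p : is_lim sigma p_infty 1)
    (* (Sigma1) sigma - 1/2 is odd *)
    (Hodd : forall x, sigma (- x) - / 2 = - (sigma x - / 2))
    (* (Sigma2) sigma in C^2(R), concave on [0, +oo) *)
    (HC1 : forall x, ex_derive sigma x)
    (HC2 : forall x, ex_derive (Derive sigma) x)
    (HC2c : forall x, continuous (Derive_n sigma 2) x)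
    (Hconc : forall x y t, 0 <= x -> 0 <= y -> 0 <= t <= 1 ->
               t * sigma x + (1 - t) * sigma y <= sigma (t * x + (1 - t) * y))
    (* (Sigma3) with exponent alpha > 1 *)
    (Halpha : 1 < alpha)
    (Hdecay : exists C M, forall x, x < M ->
               Rabs (sigma x) <= C * Rpower (Rabs x) (- 1 - alpha))
    (* standing assumption *)
    (Hs1 : sigma 1 < 1)
    (* M_1(phi_sigma') < +oo *)
    (HM1 : Rbar_lt (M_beta 1 (Derive (phi_sigma sigma))) p_infty)
    (* the box I *)
    (Hab : forall i, a i < b i)
    (* f in C(I) *)
    (Hf : cont_on_I a b f)
    (Hnu : 0 < nu < 1)
    (* || K_n f - f ||_oo = O(n^-nu) *)
    (Hrate : exists C (N : nat), forall n : nat, (N <= n)%nat -> (0 < n)%nat ->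
        Rbar_le (supnorm_I a b (fun x => K_n sigma a b f n x - f x))
                (C * Rpower (INR n) (- nu))) :
  Lip a b nu f.
Proof.
have phi0 := phi_sigma_ge0 sigma Hmono.
have sb := sigmoid_bounds sigma Hmono Hlim_m Hlim_p.
have [m m0 Hm] := phi_sigma_pos sigma Hmono Hodd (concave_sigmoid_lt sigma Hconc Hlim_p) Hs1.
have [B1 HB1] := shift_bounded_phi_sigma sigma sb.
have [B2 HB2] := shift_bounded_phi_sigma_moment sigma alpha sb Hodd Halpha Hdecay.
have M1' := shift_bounded_M_beta _ HM1.
have [B3 HB3] := shift_bounded_Derive_phi_sigma sigma HC1 HC2 M1'.
have [B4 HB4] := M1'.
pose B := 1 + Rabs B1 + Rabs B2 + Rabs B3 + Rabs B4.
have [p1 p2 p3 p4] : [/\ 0 <= Rabs B1, 0 <= Rabs B2, 0 <= Rabs B3 & 0 <= Rabs B4].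
  by split; exact: Rabs_pos.
have leB : [/\ 1 <= B, B1 <= B, B2 <= B, B3 <= B & B4 <= B].
  by rewrite /B; have := Rle_abs B1; have := Rle_abs B2; have := Rle_abs B3; have := Rle_abs B4;
    split; lra.
case: leB => B_1 b1 b2 b3 b4.
have [C0 [N1 HK]] := Hrate.
have [N2 HN2] := box_side_lower_bound d a b Hab.
have Hab' i : a i <= b i by exact: Rlt_le.
pose n0 := (N1 + N2).+1.
have n0_gt0 : 0 < / INR n0 by apply: Rinv_0_lt_compat; apply: lt_0_INR; apply/ltP.
have [E0 E00 HE0] := modulus_le_ex d a b f (/ INR n0) Hab' Hf n0_gt0.
pose L := Bernstein_const d B m.
have L0 : 0 <= L.
  have q1 : 0 <= (2 + INR d) * B ^ d.
    by apply: Rmult_le_pos; [have := pos_INR d; lra | apply: pow_le; lra].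
  have q2 : 0 < / m ^ d by apply: Rinv_0_lt_compat; exact: pow_lt.
  rewrite /L /Bernstein_const; apply: Rmult_le_pos => //.
  by have := Rmult_le_pos _ _ q1 (pow2_ge_0 (/ m ^ d)); lra.
have [C HC] : exists C, forall t, 0 < t <= / INR n0 -> modulus_le a b f t (C * Rpower t nu).
  (* The constants are those of [modulus_le_approx] with error |C0| n^(-nu) and Lipschitz constant n
     E L. *)
  apply: (Berens_Lorentz (modulus_le a b f) nu (2 * Rabs C0) (INR d * L) E0 n0) => //.
  - by have := Rabs_pos C0; lra.
  - by move=> t E E' EE' H x y Ix Iy xy; apply: Rle_trans (H x y Ix Iy xy) EE'.
  - move=> t t' E tt' H x y Ix Iy xy; apply: H => // i; exact: Rle_trans (xy i) tt'.
  move=> n E t n0n E_0 HE.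
  have n_gt0 : (0 < n)%nat by apply: leq_trans n0n.
  have N1n : (N1 <= n)%nat by apply: leq_trans n0n; rewrite /n0 -addnS leq_addr.
  have N2n : (N2 <= n)%nat by apply: leq_trans n0n; rewrite /n0 -addSn leq_addl.
  have INRn : 0 < INR n by apply: lt_0_INR; exact/ltP.
  have Ke x : inI a b x -> Rabs (K_n sigma a b f n x - f x) <= Rabs C0 * Rpower (INR n) (- nu).
    move=> Ix; apply: (Rle_trans _ (C0 * Rpower (INR n) (- nu))); last first.
      by apply: Rmult_le_compat_r; [apply: Rlt_le; exact: exp_pos | exact: Rle_abs].
    have [ub _] := Lub_Rbar_correct
      (fun r => exists x, inI a b x /\ r = Rabs (K_n sigma a b f n x - f x)).
    exact: (Rbar_le_trans (Rbar.Finite _) _ (Rbar.Finite _)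
      (ub _ (ex_intro _ x (conj Ix erefl))) (HK n N1n n_gt0)).
  have KL x i r s : inI a b x -> a i <= r <= b i -> a i <= s <= b i ->
     Rabs (K_n sigma a b f n (upd x i s) - K_n sigma a b f n (upd x i r))
     <= INR n * E * L * Rabs (s - r).
    move=> Ix Ir Is; apply: K_n_upd_lipschitz => //; try exact: HN2.
    - by move=> u l h; apply: Rle_trans (HB1 u l h) b1.
    - by move=> u l h; apply: Rle_trans (HB2 u l h) b2.
    - by move=> u l h; apply: Rle_trans (HB3 u l h) b3.
    - by move=> u l h; apply: Rle_trans (HB4 u l h) b4.
  have nEL : 0 <= INR n * E * L by repeat apply: Rmult_le_pos => //; lra.
  have := modulus_le_approx d a b f _ _ _ t nEL Ke KL.
  have -> // : 2 * (Rabs C0 * Rpower (INR n) (- nu)) + INR d * (INR n * E * L * t)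
    = 2 * Rabs C0 * Rpower (INR n) (- nu) + INR d * L * (t * INR n * E) by ring.
split=> //; exists C, (/ INR n0); split=> // delta ddelta.
have [_ lub] := Lub_Rbar_correct (fun r => exists x y, inI a b x /\ inI a b y /\
  dist2 x y <= delta /\ r = Rabs (f x - f y)).
apply: lub => _ [x [y [Ix [Iy [xy ->]]]]]; apply: HC => // i.
exact: Rle_trans (Rabs_le_dist2 d x y i) xy.
Qed.
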